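(* Let $a\in\mathbb{R}^2\setminus\{0\}$, $A=a\otimes e_2$, $B=-A$, and let $W:\mathbb{R}^{2\times2}\to[0,\infty)$ be continuous. Suppose that there is $\sigma\in(0,1/2)$ such that $$\big|\sqrt{W(M)}-\sqrt{W_0(M)}\big|\le\sigma\sqrt{W_0(M)}\qquad\text{for all }M\in\mathbb{R}^{2\times2}.$$ Then: (1) there exists $C>0$ such that $\frac1C W_0(M)\le W(M)\le C\,W_0(M)$ for all $M\in\mathbb{R}^{2\times2}$; (2) $K^*<3\,d_W(A,B)$; (3) $W$ is a double well potential, i.e. $W(M)=0$ if and only if $M\in\{A,B\}$.
   Context: Notation: $e_2$ is the second unit vector of $\mathbb{R}^2$; a matrix $M\in\mathbb{R}^{2\times2}$ is written $M=(m_1,m_2)$ with columns $m_1,m_2\in\mathbb{R}^2$, so $A=a\otimes e_2=(0,a)$; $|\cdot|$ is the Euclidean norm. $W_0(M):=|m_1|^2+\min\{|m_2-a|^2,|m_2+a|^2\}=\min\{|M-A|^2,|M-B|^2\}$. $q=(-1/2,1/2)$. For open $\omega\subset\mathbb{R}$ and $h>0$, $\omega_h:=\omega\times(-h,h)$. Energy: $E_\varepsilon(u,\Omega):=\int_\Omega \frac1\varepsilon W(\nabla u)+\varepsilon|\nabla^2u|^2\,dx$ for $\varepsilon>0$, open $\Omega\subset\mathbb{R}^2$, $u\in H^2(\Omega;\mathbb{R}^2)$. Reference map: $u_0(x)=Ax$ if $x_2>0$ and $u_0(x)=Bx$ if $x_2\le0$. Optimal profile energy: $\mathcal{F}(\omega,h):=\inf\{\liminf_{n\to\infty}E_{\varepsilon_n}(u_n,\omega_h):\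 \varepsilon_n\to0^+,\ u_n\in H^2(\omega_h;\mathbb{R}^2),\ u_n\to u_0\text{ in }L^1(\omega_h;\mathbb{R}^2)\}$. For continuous $W$ this is independent of $h$; the optimal profile constant is $K^*:=\mathcal{F}(q,h)$ (e.g. $h=1/2$). Geodesic distance: for $\varphi\in W^{1,1}([-1,1];\mathbb{R}^{2\times2})$, $L_W(\varphi):=2\int_{-1}^1\sqrt{W(\varphi(s))}\,|\varphi'(s)|\,ds$, and $d_W(M,N):=\inf\{L_W(\varphi):\varphi\in W^{1,1}([-1,1];\mathbb{R}^{2\times2}),\ \varphi(-1)=M,\ \varphi(1)=N\}$. *)

(* Defs.v *)
From HB Require Import structures.
From mathcomp Require Import all_boot all_order all_algebra.
From mathcomp Require Import all_classical all_reals all_analysis.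
Set Implicit Arguments.
Unset Strict Implicit.
Unset Printing Implicit Defensive.
Import Order.TTheory GRing.Theory Num.Theory.
Import numFieldNormedType.Exports.
Local Open Scope classical_set_scope.
Local Open Scope ring_scope.

(* The library norm on matrices and on products is the sup norm, hence the need
   for the Euclidean (Frobenius) norm. *)
Definition enorm {R : realType} {m n : nat} (M : 'M[R]_(m, n)) : R :=
  Num.sqrt (\sum_i \sum_j M i j ^+ 2).

(* Points of the domain R^2 are pairs, as Lebesgue measure on R^2 is the product
   measure on R * R; values in R^2 are column vectors. *)
Definition leb2 (R : realType) :
    {measure set (measurableTypeR R * measurableTypeR R) -> \bar R} :=
  (@lebesgue_measure R \x @lebesgue_measure R)%E.
Arguments leb2 R : clear implicits.

Definition vec {R : realType} (x : R * R) : 'cV[R]_2 :=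
  \col_(i < 2) (if i == 0 then x.1 else x.2).

Definition unit_pair (R : realType) (i : 'I_2) : R * R :=
  ((i == 0)%:R, (i == 1)%:R).

Definition e2 (R : realType) : 'cV[R]_2 := delta_mx 1 0.

Definition tensor {R : realType} (a b : 'cV[R]_2) : 'M[R]_2 := a *m b^T.

Definition W0 {R : realType} (a : 'cV[R]_2) (M : 'M[R]_2) : R :=
  enorm (col 0 M) ^+ 2
  + Num.min (enorm (col 1 M - a) ^+ 2) (enorm (col 1 M + a) ^+ 2).

(* Weak derivatives are tested against C^1 functions with compact support in
   the open set; by mollification this is the same as testing against smooth
   ones. *)
Definition C1c {R : realType} {V : normedModType R} (O : set V) (phi : V -> R) :=
  [/\ forall x, differentiable phi x,
      forall v, continuous (fun x => 'D_v phi x) &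
      exists K, [/\ compact K, K `<=` O & forall x, ~ K x -> phi x = 0]].

Definition weak_partial {R : realType} (O : set (R * R)) (i : 'I_2)
    (f g : R * R -> R) :=
  forall phi : R * R -> R, C1c O phi ->
    (\int[leb2 R]_(x in O) (f x * 'D_(unit_pair R i) phi x)%:E
     = - \int[leb2 R]_(x in O) (g x * phi x)%:E)%E.

Definition L2 {R : realType} (O : set (R * R)) (f : R * R -> R) :=
  measurable_fun O f /\ (leb2 R).-integrable O (fun x => (f x ^+ 2)%:E).

(* An element of H^2(O; R^2), given by representatives of the map and of its
   weak derivatives (unique up to null sets):
   H2_grad x i j = d_j u_i (x) and H2_hess x k i j = d_k d_j u_i (x). *)
Record H2 {R : realType} (O : set (R * R)) := MkH2 {
  H2_fun :> R * R -> 'cV[R]_2 ;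
  H2_grad : R * R -> 'M[R]_2 ;
  H2_hess : R * R -> 'I_2 -> 'M[R]_2 ;
  H2_fun_L2 : forall i, L2 O (fun x => H2_fun x i 0) ;
  H2_grad_L2 : forall i j, L2 O (fun x => H2_grad x i j) ;
  H2_hess_L2 : forall k i j, L2 O (fun x => H2_hess x k i j) ;
  H2_gradP : forall i j,
    weak_partial O j (fun x => H2_fun x i 0) (fun x => H2_grad x i j) ;
  H2_hessP : forall k i j,
    weak_partial O k (fun x => H2_grad x i j) (fun x => H2_hess x k i j)
}.

Definition energy {R : realType} (W : 'M[R]_2 -> R) (eps : R)
    (O : set (R * R)) (u : H2 O) : \bar R :=
  \int[leb2 R]_(x in O)
    (eps^-1 * W (H2_grad u x)
     + eps * \sum_k enorm (H2_hess u x k) ^+ 2)%:E.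

Definition u0 {R : realType} (A B : 'M[R]_2) (x : R * R) : 'cV[R]_2 :=
  if 0 < x.2 then A *m vec x else B *m vec x.

Definition cvg_L1 {R : realType} (O : set (R * R))
    (u : nat -> R * R -> 'cV[R]_2) (v : R * R -> 'cV[R]_2) :=
  (\int[leb2 R]_(x in O) (enorm (u n x - v x))%:E)%E @[n --> \oo] --> 0%E.

Definition cylinder {R : realType} (w : set R) (h : R) : set (R * R) :=
  w `*` `]-h, h[%classic.

Definition profile_energy {R : realType} (W : 'M[R]_2 -> R) (A B : 'M[R]_2)
    (w : set R) (h : R) : \bar R :=
  ereal_inf [set l | exists (eps : nat -> R) (u : nat -> H2 (cylinder w h)),
    [/\ forall n, 0 < eps n,
        eps n @[n --> \oo] --> 0,
        cvg_L1 (cylinder w h) u (u0 A B) &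
        l = limn_einf (fun n => energy W (eps n) (u n))]].

(* K^*; for continuous W its value is the same for all heights h > 0. *)
Definition Kstar {R : realType} (W : 'M[R]_2 -> R) (A B : 'M[R]_2) (h : R) :
    \bar R :=
  profile_energy W A B `](- 2^-1), 2^-1[%classic h.

(* An element of W^{1,1}([-1, 1]; R^(2x2)), given by its continuous
   representative (which defines its endpoint values) and by a representative of
   its weak derivative. *)
Record W11 (R : realType) := MkW11 {
  W11_fun :> R -> 'M[R]_2 ;
  W11_der : R -> 'M[R]_2 ;
  W11_cont : {within `[-1, 1]%classic, continuous W11_fun} ;
  W11_fun_L1 : forall i j, (@lebesgue_measure R).-integrable `[-1, 1]%classic
                 (fun s => (W11_fun s i j)%:E) ;
  W11_der_L1 : forall i j, (@lebesgue_measure R).-integrable `[-1, 1]%classic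
                 (fun s => (W11_der s i j)%:E) ;
  W11_derP : forall (i j : 'I_2) (eta : R -> R),
    @C1c R R `]-1, 1[%classic eta ->
    (\int[@lebesgue_measure R]_(s in `](-1)%R, 1%R[) (W11_fun s i j * derive1 eta s)%:E
     = - \int[@lebesgue_measure R]_(s in `](-1)%R, 1%R[) (W11_der s i j * eta s)%:E)%E
}.

Definition LW {R : realType} (W : 'M[R]_2 -> R) (phi : W11 R) : \bar R :=
  (2%:E * \int[@lebesgue_measure R]_(s in `[(-1)%R, 1%R])
            (Num.sqrt (W (phi s)) * enorm (W11_der phi s))%:E)%E.

Definition dW {R : realType} (W : 'M[R]_2 -> R) (M N : 'M[R]_2) : \bar R :=
  ereal_inf [set LW W phi | phi in [set phi : W11 R | phi (-1) = M /\ phi 1 = N]].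

(* Main.v *)
Require Import Defs.
From HB Require Import structures.
From mathcomp Require Import all_boot all_order all_algebra.
From mathcomp Require Import all_classical all_reals all_analysis.
From mathcomp Require Import measurable_realfun ring lra.
Set Implicit Arguments.
Unset Strict Implicit.
Unset Printing Implicit Defensive.
Import Order.TTheory GRing.Theory Num.Theory.
Import numFieldNormedType.Exports.
Local Open Scope classical_set_scope.
Local Open Scope ring_scope.

(* The two bounds 2 (1 - sigma) |a|^2 <= d_W(A, B) and
   K^* <= 2 (1 + sigma) |a|^2 give (2), since 1 + sigma < 3 (1 - sigma).

   Lower bound. Let p be the coordinate of the second column along a, in units
   of |a|; a competitor phi has p = 1 at A and p = -1 at B. As
   sqrt(W_0) >= |a| |1 - |p|| and |phi'| >= |a| |p'|, its length is at least
   2 (1 - sigma) |a|^2 times the total variation of G(p), where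
   G(x) = x - x|x|/2 is a primitive of 1 - |x| with G(1) - G(-1) = 1.

   Upper bound. The maps u = (|x_2| + e^(-k|x_2|)/k) a with k = (1 + sigma)/eps
   are of class C^2 and equipartition the energy bounded by
   W <= (1 + sigma)^2 W_0: their gradient is gamma A with
   gamma' = k (1 - |gamma|). Each of them has energy at most
   2 (1 + sigma) |a|^2. *)

(** * Measurability and differentiation of real functions *)

(** For [W0] itself both bounds are sharp: the segment from A to B has length 2|a|^2, and the
    exponential profile runs along it with that energy in the limit. The only loss is therefore
    sigma, and sigma = 1/2 is where (1 + sigma)/(1 - sigma) reaches 3. The profile solves its
    equation on the whole line, so no cutoff at the boundary of the cylinder enters and one formula
    serves every height.

    The obstacle in the lower bound is that a competitor is known only through a weak derivative
    tested against C^1 functions; neither a fundamental theorem of calculus nor a chain rule for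
    G(p) is at hand. Bump functions recover |p(s) - p(t)| <= int |psi| over [s, t], where psi is the
    weak derivative of p. The chain rule is replaced by subdivision: where p oscillates by less than
    d, chords of G have slope at most |1 - |p(x)|| + d in absolute value, for every x in the piece.
    The total error d int |psi| vanishes with d. *)

Lemma open_measurable_prod (R : realType) (U : set (R * R)) :
  open U -> measurable (U : set (measurableTypeR R * measurableTypeR R)).
Proof.
move=> oU.
(* The product sigma-algebra is given by rectangles, not by open sets; an open set is the countable
   union of the boxes with rational corners that it contains. *)
pose box (q : (rat * rat) * (rat * rat)) : set (R * R) :=
  `]ratr q.1.1, ratr q.1.2[%classic `*` `]ratr q.2.1, ratr q.2.2[%classic.
pose F q : set (measurableTypeR R * measurableTypeR R) :=
  if `[< box q `<=` U >] then box q else set0.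
have -> : U = \bigcup_q F q.
  apply/seteqP; split=> [[x y] Uxy|[x y] [q _]]; last first.
    by rewrite /F; case: ifPn => // /asboolP; exact.
  have /nbhs_ballP[e /= e0 xyU] : nbhs (x, y) U by exact: open_nbhs_nbhs.
  have rat_between (z1 z2 : R) : z1 < z2 -> exists q : rat, z1 < ratr q < z2.
    by move=> /rat_in_itvoo[q]; rewrite in_itv/=; exists q.
  have [|q1 /andP[q1x xq1]] := rat_between (x - e) x; first by lra.
  have [|q2 /andP[q2x xq2]] := rat_between x (x + e); first by lra.
  have [|q3 /andP[q3y yq3]] := rat_between (y - e) y; first by lra.
  have [|q4 /andP[q4y yq4]] := rat_between y (y + e); first by lra.
  exists ((q1, q2), (q3, q4)) => //; rewrite /F; case: ifPn => [_|/asboolP].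
    by split; rewrite /= in_itv/=; apply/andP.
  case => -[s t] [] /=; rewrite !in_itv/= => /andP[? ?] /andP[? ?].
  by apply: xyU; split; rewrite /ball/= ltr_distlC; apply/andP; split; lra.
apply: countable_bigcupT_measurable => // q.
rewrite /F; case: ifPn => // _.
by apply: measurableX; exact: measurable_itv.
Qed.

Lemma continuous_measurable_prod (R : realType) (f : R * R -> R) :
  continuous f ->
  measurable_fun setT (f : measurableTypeR R * measurableTypeR R -> R).
Proof.
move=> /continuousP cf; apply: (measurability _ (RGenOpens.measurableE R)).
move=> _ [_ [a [b ->] <-]]; rewrite setTI; apply: open_measurable_prod.
exact/cf/interval_open.
Qed.

Lemma is_derive_cvg (R : realType) (f : R -> R) (x d : R) :
  is_derive x 1 f d <-> h^-1 * (f (h + x) - f x) @[h --> 0^'] --> d.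
Proof.
split=> [[df <-]|fd].
  rewrite /derive; move: df; rewrite /derivable => df.
  by under eq_fun do rewrite -[X in f (X + _)]mulr1; exact: df.
have fd' : h^-1 *: ((f \o shift x) (h *: 1) - f x) @[h --> 0^'] --> d.
  by under eq_fun do rewrite /= [X in f (X + _)]mulr1.
by apply: DeriveDef; [apply/cvg_ex; exists d|exact: cvg_lim].
Qed.

(** At 0 both branches share value and slope, so their difference quotients have the same limit and
    the branch selected by [h] does not matter. *)
Lemma is_derive_piecewise (R : realType) (f g f' g' : R -> R) :
  (forall x : R, is_derive x 1 f (f' x)) ->
  (forall x : R, is_derive x 1 g (g' x)) ->
  f 0 = g 0 -> f' 0 = g' 0 ->
  forall x : R, is_derive x 1 (fun y => if 0 < y then f y else g y)
                              (if 0 < x then f' x else g' x).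
Proof.
move=> df dg fg0 fg'0 x; have [x0|x0|<-] := ltgtP 0 x.
- apply: (near_eq_is_derive (f := f)) => //.
  by near=> y; rewrite ifT//; near: y; exact: lt_nbhsr.
- apply: (near_eq_is_derive (f := g)) => //.
  by near=> y; rewrite ifF//; apply/negbTE; rewrite -leNgt ltW//;
    near: y; exact: lt_nbhsl.
have /is_derive_cvg/cvgrPdist_lt qf := df 0.
have /is_derive_cvg/cvgrPdist_lt qg := dg 0.
apply/is_derive_cvg/cvgrPdist_lt => e e0.
near=> h; rewrite ltxx /=; case: ifPn => _.
  by rewrite -fg0 -fg'0; near: h; exact: qf.
by near: h; exact: qg.
Unshelve. all: by end_near. Qed.

(** * The one-dimensional transition layer *)

Definition bell (R : realType) (k y : R) : R := expR (- (k * `|y|)).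

(** The odd solution of gamma' = k (1 - |gamma|) with gamma(0) = 0, written by cases to suit
    [is_derive_piecewise]; [bell] is 1 - |gamma|. *)
Definition layer (R : realType) (k y : R) : R :=
  if 0 < y then 1 - expR (- k * y) else expR (k * y) - 1.

(** A primitive of [layer k] within 1/k of |y|: the exponential rounds the corner at 0. *)
Definition rounded_abs (R : realType) (k y : R) : R :=
  if 0 < y then y + expR (- k * y) / k else - y + expR (k * y) / k.

Section profile.
Variables (R : realType) (k : R).
Hypothesis k0 : 0 < k.

Lemma bellE y : bell k y = if 0 < y then expR (- k * y) else expR (k * y).
Proof.
rewrite /bell; case: ltrP => y0; first by rewrite gtr0_norm// mulNr.
by rewrite ler0_norm// mulrN opprK.
Qed.

Lemma bell_gt0 y : 0 < bell k y. Proof. exact: expR_gt0. Qed.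

Lemma bell_le1 y : bell k y <= 1.
Proof. by rewrite -expR0 ler_expR oppr_le0 mulr_ge0// ltW. Qed.

Lemma normr_layer y : `|layer k y| = 1 - bell k y.
Proof.
have := bell_le1 y; rewrite /layer bellE; case: ifPn => _ b1.
  by rewrite ger0_norm ?subr_ge0.
by rewrite ler0_norm ?subr_le0// opprB.
Qed.

Lemma rounded_absE y : rounded_abs k y = `|y| + bell k y / k.
Proof.
rewrite /rounded_abs bellE; case: ltrP => y0; first by rewrite gtr0_norm.
by rewrite ler0_norm.
Qed.

Lemma is_derive_expRMl (m x : R) :
  is_derive x 1 (fun y => expR (m * y)) (m * expR (m * x)).
Proof.
have dm : is_derive x 1 (fun y : R => m * y) m.
  by have := is_deriveZ m (is_derive_id x (1 : R)); rewrite /= scaler1.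
by rewrite mulrC; exact: (@is_derive1_comp R expR (fun y => m * y)).
Qed.

Lemma is_derive_layer (x : R) : is_derive x 1 (layer k) (k * bell k x).
Proof.
rewrite bellE (_ : k * _ =
  if 0 < x then k * expR (- k * x) else k * expR (k * x)); last by case: ifP.
apply: (@is_derive_piecewise _ (fun y => 1 - expR (- k * y))
  (fun y => expR (k * y) - 1) (fun y => k * expR (- k * y))
  (fun y => k * expR (k * y))) => [y|y||].
- have d := is_derive_expRMl (- k) y.
  by apply: is_derive_eq; ring.
- have d := is_derive_expRMl k y.
  by apply: is_derive_eq; rewrite subr0.
- by rewrite !mulr0 expR0.
- by rewrite !mulr0.
Qed.

Lemma is_derive_rounded_abs (x : R) :
  is_derive x 1 (rounded_abs k) (layer k x).
Proof.
have kn0 : k != 0 by rewrite gt_eqF.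
apply: (@is_derive_piecewise _ (fun y => y + expR (- k * y) / k)
  (fun y => - y + expR (k * y) / k) (fun y => 1 - expR (- k * y))
  (fun y => expR (k * y) - 1)) => [y|y||].
- have d := is_derive_expRMl (- k) y.
  by apply: is_derive_eq; rewrite /GRing.scale/=; field.
- have d := is_derive_expRMl k y.
  by apply: is_derive_eq; rewrite /GRing.scale/=; field.
- by rewrite !mulr0 oppr0.
- by rewrite !mulr0 expR0.
Qed.

Lemma continuous_bell : continuous (bell k).
Proof.
move=> x; apply: continuous_comp; last exact: continuous_expR.
apply: cvgN; apply: cvgM; first exact: cvg_cst.
exact: norm_continuous.
Qed.

End profile.

(** * Classical derivatives as weak derivatives *)

Lemma leb2_setX (R : realType) (A B : set (measurableTypeR R)) :
  measurable A -> measurable B ->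
  leb2 R (A `*` B) = (@lebesgue_measure R A * @lebesgue_measure R B)%E.
Proof. by move=> mA mB; exact: product_measure1E. Qed.

Lemma integral_derive_compact_support (R : realType) (h dh : R -> R) (M : R) :
  0 < M -> (forall x : R, is_derive x 1 h (dh x)) -> continuous dh ->
  (forall x, M <= `|x| -> h x = 0) -> (forall x, M < `|x| -> dh x = 0) ->
  (\int[@lebesgue_measure R]_x (dh x)%:E = 0)%E.
Proof.
move=> M0 dhE cdh h0 dh0.
rewrite (_ : (fun x => (dh x)%:E) = (fun x => (dh x)%:E) \_ `[- M, M]); last first.
  apply/funext => x; rewrite patchE mem_setE in_itv/= -ler_norml.
  by case: leP => // /dh0 ->.
rewrite -integral_mkcond (@continuous_FTC2 _ dh h).
- by rewrite !h0 ?subee// ?normrN gtr0_norm.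
- by lra.
- exact: continuous_subspaceT.
- have ch (x : R) : {for x, continuous h}.
    by apply/differentiable_continuous/derivable1_diffP; case: (dhE x).
  split => [x _||]; first by case: (dhE x).
  + exact/cvg_at_right_filter/ch.
  + exact/cvg_at_left_filter/ch.
- by move=> x _; rewrite derive1E; case: (dhE x).
Qed.

Lemma compact_in_box (R : realType) (K : set (R * R)) : compact K ->
  exists2 M : R, 0 < M & forall x, K x -> `|x.1| < M /\ `|x.2| < M.
Proof.
move=> /compact_bounded[N [_ NK]].
(* Boundedness holds for every number above [N], which may be negative: |N| + 1 is such a number,
   and one more unit makes the bound strict. *)
exists (`|N| + 2); first by rewrite ltr_pwDr.
move=> x /NK /= xM; have {xM} : `|x| <= `|N| + 1.
  by apply: xM; rewrite (le_lt_trans (ler_norm _))// ltrDl.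
rewrite prod_normE ge_max => /andP[x1 x2]; split; lra.
Qed.

Lemma compact_support_integrable (R : realType) (K : set (R * R)) (F : R * R -> R) :
  compact K -> continuous F -> (forall x, ~ K x -> F x = 0) ->
  (leb2 R).-integrable setT (EFin \o F).
Proof.
move=> cK cF F0; have [M M0 KM] := compact_in_box cK.
pose box : set (measurableTypeR R * measurableTypeR R) :=
  `[- M, M]%classic `*` `[- M, M]%classic.
have mbox : measurable box by apply: measurableX; exact: measurable_itv.
have -> : EFin \o F = (EFin \o F) \_ box.
  apply/funext => x; rewrite patchE; case: ifPn => // /negP xbox /=.
  rewrite F0// => /KM[x1 x2]; apply: xbox; rewrite inE; split;
    by rewrite /= in_itv/= -ler_norml ltW.
apply/(integrable_mkcond _ mbox). apply: (@measurable_bounded_integrable _ _ R (leb2 R) F) => //.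
- rewrite leb2_setX; try exact: measurable_itv.
  rewrite [X in (X * _)%E]lebesgue_measure_itv/= [X in (_ * X)%E]lebesgue_measure_itv/=.
  by case: ifPn => _; rewrite -?EFinB -?EFinM ?mule0 ltry.
- by apply: measurable_funS (continuous_measurable_prod cF).
- have /compact_bounded[N [_ NK]] := continuous_compact (continuous_subspaceT cF) cK.
  exists `|N|; split; first exact: num_real.
  move=> y Ny x _ /=; have [Kx|/F0 ->] := pselect (K x).
    by apply: NK; [rewrite (le_lt_trans (ler_norm _))|exists x].
  by rewrite normr0 (le_trans _ (ltW Ny)).
Qed.

Lemma is_derive_slice1 (R : realType) (F : R * R -> R) (x y d : R) :
  is_derive (x, y) (unit_pair R 0) F d -> is_derive x 1 (fun s => F (s, y)) d.
Proof.
move=> [dF <-]; apply/is_derive_cvg.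
have E : (fun h => h^-1 *: ((F \o shift (x, y)) (h *: unit_pair R 0) - F (x, y)))
    = (fun h => h^-1 * (F (h + x, y) - F (x, y))).
  apply/funext => h /=; rewrite (_ : h *: unit_pair R 0 + (x, y) = (h + x, y))//.
  have -> : unit_pair R 0 = (1, 0) by [].
  by congr (_, _); rewrite /= /GRing.scale/= ?mulr1// mulr0 add0r.
by move: dF; rewrite /derive /derivable E.
Qed.

Lemma is_derive_slice2 (R : realType) (F : R * R -> R) (x y d : R) :
  is_derive (x, y) (unit_pair R 1) F d -> is_derive y 1 (fun t => F (x, t)) d.
Proof.
move=> [dF <-]; apply/is_derive_cvg.
have E : (fun h => h^-1 *: ((F \o shift (x, y)) (h *: unit_pair R 1) - F (x, y)))
    = (fun h => h^-1 * (F (x, h + y) - F (x, y))).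
  apply/funext => h /=; rewrite (_ : h *: unit_pair R 1 + (x, y) = (x, h + y))//.
  have -> : unit_pair R 1 = (0, 1) by [].
  by congr (_, _); rewrite /= /GRing.scale/= ?mulr1// mulr0 add0r.
by move: dF; rewrite /derive /derivable E.
Qed.

(** By Fubini the variable of differentiation is integrated first; on each line parallel to that
    axis the boundary terms vanish. *)
Lemma integral_partial_compact_support (R : realType) (i : 'I_2) (K : set (R * R))
    (F G : R * R -> R) :
  compact K -> continuous G -> (forall x, is_derive x (unit_pair R i) F (G x)) ->
  (forall x, ~ K x -> F x = 0) -> (forall x, ~ K x -> G x = 0) ->
  (\int[leb2 R]_x (G x)%:E = 0)%E.
Proof.
move=> cK cG FG F0 G0; have [M M0 KM] := compact_in_box cK.
have intG := compact_support_integrable cK cG G0.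
have cfst (x : R) : continuous (fun y : R => (x, y)).
  by move=> y; exact: (cvg_pair (cvg_cst x) cvg_id).
have csnd (y : R) : continuous (fun x : R => (x, y)).
  by move=> x; exact: (cvg_pair cvg_id (cvg_cst y)).
have [i0|i1] := eqVneq i 0.
  rewrite -(integral21_prod_meas1 intG); apply: integral0_eq => y _; rewrite /fubini_G.
  apply: (@integral_derive_compact_support _ (fun s => F (s, y)) (fun s => G (s, y)) M) => //.
  - by move=> x; apply: is_derive_slice1; rewrite -i0.
  - by move=> x; apply: (@continuous_comp _ _ _ (fun x => (x, y)) G);
      [exact: csnd|exact: cG].
  - by move=> x Mx; apply: F0 => /KM[/= + _]; rewrite ltNge Mx.
  - by move=> x Mx; apply: G0 => /KM[/= + _]; rewrite ltNge ltW.
have {}i1 : i = 1 by apply/val_inj; case: i i1 {FG} => -[|[]].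
rewrite -(integral12_prod_meas1 intG); apply: integral0_eq => x _; rewrite /fubini_F.
apply: (@integral_derive_compact_support _ (fun y => F (x, y)) (fun y => G (x, y)) M) => //.
- by move=> y; apply: is_derive_slice2; rewrite -i1.
- by move=> y; apply: (@continuous_comp _ _ _ (fun y => (x, y)) G);
    [exact: cfst|exact: cG].
- by move=> y My; apply: F0 => /KM[/= _]; rewrite ltNge My.
- by move=> y My; apply: G0 => /KM[/= _]; rewrite ltNge ltW.
Qed.

Lemma derive_off_support (R : realType) (V : normedModType R) (phi : V -> R)
    (K : set V) (v x : V) :
  closed K -> (forall y, ~ K y -> phi y = 0) -> ~ K x -> 'D_v phi x = 0.
Proof.
move=> cK phi0 Kx; rewrite (@near_eq_derive _ _ _ _ (cst 0)) ?derive_cst//.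
have : nbhs x (~` K) by apply: open_nbhs_nbhs; split => //; exact: closed_openC.
by apply: filterS => y /phi0.
Qed.

(** The product rule makes f D phi + g phi the partial derivative of f phi, which has compact
    support, so its integral is 0. Both terms vanish off a compact subset of [O], so integrals over
    [O] are integrals over the plane. *)
Lemma weak_partial_C1 (R : realType) (O : set (R * R)) (i : 'I_2)
    (f g : R * R -> R) :
  measurable (O : set (measurableTypeR R * measurableTypeR R)) ->
  continuous f -> continuous g ->
  (forall x, is_derive x (unit_pair R i) f (g x)) ->
  weak_partial O i f g.
Proof.
move=> mO cf cg fg phi [dphi cdphi [K [cK KO phi0]]].
have Dphi0 x : ~ K x -> 'D_(unit_pair R i) phi x = 0.
  by apply: derive_off_support => //; apply: compact_closed => //.
have cphi : continuous phi by move=> x; exact: differentiable_continuous.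
pose F x := f x * 'D_(unit_pair R i) phi x.
pose G x := g x * phi x.
have F0 x : ~ K x -> F x = 0 by move=> /Dphi0 e; rewrite /F e mulr0.
have G0 x : ~ K x -> G x = 0 by move=> /phi0 e; rewrite /G e mulr0.
have cF : continuous F by move=> x; apply: cvgM; [exact: cf|exact: cdphi].
have cG : continuous G by move=> x; apply: cvgM; [exact: cg|exact: cphi].
have onO (H : R * R -> R) : (forall x, ~ K x -> H x = 0) ->
    (\int[leb2 R]_(x in O) (H x)%:E = \int[leb2 R]_x (H x)%:E)%E.
  move=> H0; rewrite integral_mkcond; apply: eq_integral => x _.
  rewrite patchE; case: ifPn => // /negP; rewrite inE => Ox.
  by rewrite H0// => /KO.
rewrite (onO F)// (onO G)//.
have iF := compact_support_integrable cK cF F0; have iG := compact_support_integrable cK cG G0.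
have : (\int[leb2 R]_x (F x + G x)%:E = 0)%E.
  apply: (@integral_partial_compact_support _ i K (fun x => f x * phi x)) => //.
  - by move=> x; apply: cvgD; [exact: cF|exact: cG].
  - move=> x; have dp := derivableP (@diff_derivable _ _ _ phi x (unit_pair R i) (dphi x)).
    have df := fg x; have dfp := is_deriveM df dp.
    by apply: (is_derive_eq dfp); rewrite /GRing.scale/= /F /G [X in _ + X]mulrC.
  - by move=> x /phi0 ->; rewrite mulr0.
  - by move=> x Kx; rewrite F0// G0// addr0.
under eq_integral do rewrite EFinD.
rewrite (integralD _ iF iG)//.
(* Finiteness turns a zero sum of extended reals into an equality of opposites. *)
have /fineK <- : (\int[leb2 R]_x (EFin \o F) x)%E \is a fin_num.
  exact: integrable_fin_num iF.
have /fineK <- : (\int[leb2 R]_x (EFin \o G) x)%E \is a fin_num.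
  exact: integrable_fin_num iG.
by rewrite -EFinD => -[] /eqP; rewrite addr_eq0 => /eqP ->.
Qed.

(** * The recovery sequence *)

Lemma is_derive1_continuous (R : realType) (f f' : R -> R) :
  (forall x : R, is_derive x 1 f (f' x)) -> continuous f.
Proof.
move=> df x; apply/differentiable_continuous/derivable1_diffP.
by case: (df x).
Qed.

(** The factor [(j == 1)%:R] covers both axes at once: a function of x_2 is constant along the
    first. *)
Lemma is_derive_comp_snd (R : realType) (f : R -> R) (d : R) (x : R * R)
    (j : 'I_2) :
  is_derive x.2 1 f d ->
  is_derive x (unit_pair R j) (f \o snd) ((j == 1)%:R * d).
Proof.
move=> /is_derive_cvg fd; case: x fd => x y /= fd.
have fd' : h^-1 *: ((f \o snd \o shift (x, y)) (h *: unit_pair R j)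
    - (f \o snd) (x, y)) @[h --> 0^'] --> (j == 1)%:R * d.
  have [->|j0] := eqVneq j 1.
    rewrite mul1r; apply: cvg_trans fd; apply: near_eq_cvg; near=> h.
    by rewrite /unit_pair /= [h *: _]mulr1.
  rewrite mul0r (_ : (fun h => _) = cst 0); first exact: cvg_cst.
  apply/funext => h /=; rewrite /unit_pair (negbTE j0) /=.
  by rewrite scaler0 add0r subrr scaler0.
by apply: DeriveDef; [apply/cvg_ex; eexists; exact: fd'|exact: cvg_lim].
Unshelve. all: by end_near. Qed.

Lemma compact_cylinder (R : realType) (a b h : R) :
  compact (`[a, b]%classic `*` `[- h, h]%classic : set (R * R)).
Proof. by apply: compact_setX; exact: segment_compact. Qed.

Lemma cylinder_sub (R : realType) (a b h : R) :
  cylinder `]a, b[%classic h `<=` `[a, b]%classic `*` `[- h, h]%classic.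
Proof.
by move=> x [] /=; rewrite !in_itv/= => /andP[/ltW -> /ltW ->] /andP[/ltW -> /ltW ->].
Qed.

Lemma measurable_cylinder (R : realType) (a b h : R) :
  measurable (cylinder `]a, b[%classic h : set (measurableTypeR R * measurableTypeR R)).
Proof. by apply: measurableX; exact: measurable_itv. Qed.

Lemma leb2_cylinder (R : realType) (a b h : R) : a < b -> 0 < h ->
  leb2 R (cylinder `]a, b[%classic h) = ((b - a) * (2 * h))%:E.
Proof.
move=> ab h0; rewrite /cylinder leb2_setX; try exact: measurable_itv.
rewrite [X in (X * _)%E]lebesgue_measure_itv/= [X in (_ * X)%E]lebesgue_measure_itv/=.
rewrite !lte_fin ab (_ : - h < h) ?gtrN// -!EFinB -EFinM.
by congr (_ * _)%:E; ring.
Qed.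

Lemma L2_continuous (R : realType) (a b h : R) (f : R * R -> R) :
  a < b -> 0 < h -> continuous f -> L2 (cylinder `]a, b[%classic h) f.
Proof.
move=> ab h0 cf; have mf := continuous_measurable_prod cf.
have mO := @measurable_cylinder _ a b h.
split; first exact: measurable_funTS.
apply: (@measurable_bounded_integrable _ _ R (leb2 R) (fun x => f x ^+ 2)) => //.
- by rewrite leb2_cylinder// ltry.
- by apply: measurable_funX; exact: measurable_funTS.
- have [N [_ NK]] := compact_bounded (continuous_compact (continuous_subspaceT cf)
    (@compact_cylinder _ a b h)).
  exists ((`|N| + 1) ^+ 2); split; first exact: num_real.
  move=> M NM x Ox /=; rewrite normrX (le_trans _ (ltW NM))//.
  rewrite lerXn2r ?nnegrE ?addr_ge0//.
  apply: NK; first by rewrite (le_lt_trans (ler_norm _))// ltrDl.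
  by exists x => //; exact: cylinder_sub.
Qed.

Lemma tensor_e2E (R : realType) (a : 'cV[R]_2) (i j : 'I_2) :
  tensor a (e2 R) i j = a i 0 * (j == 1)%:R.
Proof. by rewrite /tensor /e2 mxE big_ord1 !mxE andbT. Qed.

Lemma weak_partial_comp_snd (R : realType) (O : set (R * R)) (j : 'I_2)
    (f f' : R -> R) (c : R) :
  measurable (O : set (measurableTypeR R * measurableTypeR R)) ->
  continuous f' -> (forall x : R, is_derive x 1 f (f' x)) ->
  weak_partial O j (fun x => f x.2 * c) (fun x => f' x.2 * (c * (j == 1)%:R)).
Proof.
move=> mO cf' df; apply: weak_partial_C1 => //.
- move=> x; apply: cvgMl; apply: continuous_comp; first exact: cvg_snd.
  exact: (is_derive1_continuous df).
- move=> x; apply: cvgMl; apply: continuous_comp; first exact: cvg_snd.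
  exact: cf'.
- move=> x; have d := is_derive_comp_snd j (df x.2).
  have dc := is_deriveM d (is_derive_cst c x (unit_pair R j)).
  by apply: (is_derive_eq dc); rewrite /GRing.scale/=; ring.
Qed.

(** For a map f(x_2) a the gradient is f'(x_2) times a (x) e_2, and only its derivative along x_2
    survives. All representatives are continuous on the plane, hence bounded on the cylinder, which
    gives square integrability. *)
Lemma profile_H2 (R : realType) (a : 'cV[R]_2) (k l r h : R) :
  0 < k -> l < r -> 0 < h ->
  exists u : H2 (cylinder `]l, r[%classic h),
    [/\ H2_fun u = fun x => rounded_abs k x.2 *: a,
        H2_grad u = fun x => layer k x.2 *: tensor a (e2 R) &
        H2_hess u = fun x m => (k * bell k x.2) *: ((m == 1)%:R *: tensor a (e2 R))].
Proof.
move=> k0 lr h0; set O := cylinder _ _.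
pose A := tensor a (e2 R).
have mO : measurable (O : set (measurableTypeR R * measurableTypeR R)).
  exact: measurable_cylinder.
have cb : continuous (fun y => k * bell k y).
  by move=> y; apply: cvgMr; exact: continuous_bell.
have cl := is_derive1_continuous (is_derive_layer k).
have cr := is_derive1_continuous (is_derive_rounded_abs k0).
have L2snd (f : R -> R) c : continuous f -> L2 O (fun x => f x.2 * c).
  move=> cf; apply: L2_continuous => // x; apply: cvgMl.
  by apply: continuous_comp; [exact: cvg_snd|exact: cf].
pose u (x : R * R) := rounded_abs k x.2 *: a.
pose g (x : R * R) := layer k x.2 *: A.
pose s (x : R * R) (m : 'I_2) := (k * bell k x.2) *: ((m == 1)%:R *: A).
have uE i : (fun x => u x i 0) = fun x => rounded_abs k x.2 * a i 0.
  by apply/funext => x; rewrite mxE.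
have gE i j : (fun x => g x i j) = fun x => layer k x.2 * A i j.
  by apply/funext => x; rewrite mxE.
have sE m i j : (fun x => s x m i j) =
    fun x => k * bell k x.2 * (A i j * (m == 1)%:R).
  by apply/funext => x; rewrite !mxE; ring.
have uL2 i : L2 O (fun x => u x i 0) by rewrite uE; exact: L2snd.
have gL2 i j : L2 O (fun x => g x i j) by rewrite gE; exact: L2snd.
have sL2 m i j : L2 O (fun x => s x m i j).
  by rewrite sE; exact: (L2snd (fun y => k * bell k y)).
have uP i j : weak_partial O j (fun x => u x i 0) (fun x => g x i j).
  rewrite uE gE tensor_e2E.
  exact: (weak_partial_comp_snd _ _ mO cl (is_derive_rounded_abs k0)).
have gP m i j : weak_partial O m (fun x => g x i j) (fun x => s x m i j).
  rewrite gE sE.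
  exact: (weak_partial_comp_snd _ _ mO cb (is_derive_layer k)).
by exists (MkH2 uL2 gL2 sL2 uP gP).
Qed.

(** * Euclidean norm, and [W0] on the segment between the wells *)

Lemma enorm_sqr (R : realType) m n (M : 'M[R]_(m, n)) :
  enorm M ^+ 2 = \sum_i \sum_j M i j ^+ 2.
Proof.
by rewrite sqr_sqrtr// sumr_ge0// => i _; rewrite sumr_ge0// => j _; exact: sqr_ge0.
Qed.

Lemma enormZ (R : realType) m n (t : R) (M : 'M[R]_(m, n)) :
  enorm (t *: M) = `|t| * enorm M.
Proof.
rewrite /enorm -sqrtr_sqr -sqrtrM ?sqr_ge0//; congr Num.sqrt.
rewrite mulr_sumr; apply: eq_bigr => i _; rewrite mulr_sumr.
by apply: eq_bigr => j _; rewrite mxE exprMn.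
Qed.

Lemma enorm_tensor_e2 (R : realType) (a : 'cV[R]_2) :
  enorm (tensor a (e2 R)) = enorm a.
Proof.
rewrite /enorm; congr Num.sqrt; apply: eq_bigr => i _.
by rewrite big_ord1 !big_ord_recl big_ord0 !tensor_e2E /= mulr0 mulr1 expr0n add0r addr0.
Qed.

Lemma tensor_e2_vec (R : realType) (a : 'cV[R]_2) (x : R * R) :
  tensor a (e2 R) *m vec x = x.2 *: a.
Proof.
apply/colP => i; rewrite !mxE !big_ord_recl big_ord0 !tensor_e2E !mxE /=.
by rewrite mulr0 mul0r add0r addr0 mulr1 mulrC.
Qed.

Lemma W0_scale_tensor (R : realType) (a : 'cV[R]_2) (t : R) :
  W0 a (t *: tensor a (e2 R)) <= ((1 - `|t|) * enorm a) ^+ 2.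
Proof.
rewrite /W0 (_ : col 0 _ = 0 *: a); last first.
  by apply/colP => i; rewrite !mxE big_ord1 !mxE /= !mulr0 mul0r.
rewrite (_ : col 1 _ = t *: a); last first.
  by apply/colP => i; rewrite !mxE big_ord1 !mxE /= !mulr1.
rewrite enormZ normr0 mul0r expr0n add0r ge_min.
rewrite -[X in enorm (_ - X)]scale1r -[X in enorm (_ + X)]scale1r.
rewrite -scalerBl -scalerDl !enormZ !exprMn !real_normK ?num_real//.
(* The well on the side of the sign of [t] lies at distance |1 - |t|| |a|. *)
have [t0|t0] := ger0P t; apply/orP; [left|right];
  by rewrite ler_wpM2r ?sqr_ge0//; lra.
Qed.

Lemma integral_cylinder_snd (R : realType) (l r h : R) (f : R -> R) :
  l < r -> (forall y, 0 <= f y) -> continuous f ->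
  (\int[leb2 R]_(x in cylinder `]l, r[%classic h) (f x.2)%:E =
   (r - l)%:E * \int[@lebesgue_measure R]_(y in `](- h)%R, h[) (f y)%:E)%E.
Proof.
move=> lr f0 cf; set O := cylinder _ _.
have mO : measurable (O : set (measurableTypeR R * measurableTypeR R)).
  exact: measurable_cylinder.
have mf : measurable_fun setT
    (fun x : measurableTypeR R * measurableTypeR R => (f x.2)%:E).
  apply/measurable_EFinP; apply: continuous_measurable_prod => x.
  by apply: continuous_comp; [exact: cvg_snd|exact: cf].
rewrite integral_mkcond /leb2 fubini_tonelli2//=; last 2 first.
- apply/(measurable_restrictT _ mO); exact: measurable_funTS.
- by move=> x; apply: erestrict_ge0 => y _; rewrite lee_fin.
rewrite -ge0_integralZl//=; last 3 first.
- by apply/measurable_EFinP/measurable_funTS; exact: continuous_measurable_fun.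
- by move=> y _; rewrite lee_fin.
- by rewrite lee_fin subr_ge0 ltW.
rewrite [RHS]integral_mkcond; apply: eq_integral => y _.
rewrite /fubini_G patchE; case: ifPn => yh.
  rewrite (_ : (fun x => _) = cst (f y)%:E \_ `]l, r[); last first.
    apply/funext => x; rewrite !patchE; congr (if _ then _ else _).
    by rewrite /O /cylinder in_setX yh andbT.
  rewrite -integral_mkcond integral_cst//= lebesgue_measure_itv/= lte_fin lr.
  by rewrite -EFinB muleC.
apply: integral0_eq => x _; rewrite patchE /O /cylinder in_setX (negbTE yh).
by rewrite andbF.
Qed.

Lemma bell_sqr (R : realType) (k y : R) : bell k y ^+ 2 = bell (2 * k) y.
Proof. by rewrite /bell -expRM_natl; congr expR; ring. Qed.

Lemma integral_bell (R : realType) (k h : R) : 0 < k -> 0 < h ->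
  (\int[@lebesgue_measure R]_(y in `](- h)%R, h[) (k * bell k y)%:E <= 2%:E)%E.
Proof.
move=> k0 h0; have cb : continuous (fun y => k * bell k y).
  by move=> y; apply: cvgMr; exact: continuous_bell.
rewrite -(@integral_itv_bndoo _ _ _ _ true false); last first.
  by apply/measurable_EFinP/measurable_funTS; exact: continuous_measurable_fun.
have cl := is_derive1_continuous (is_derive_layer k).
(* The integrand is the derivative of [layer k], whose values stay strictly between -1 and 1; hence
   a bound independent of [k] and [h]. *)
rewrite (@continuous_FTC2 _ _ (layer k)).
- rewrite -EFinB lee_fin; have := normr_layer k0 h; have := normr_layer k0 (- h).
  have := bell_gt0 k h; have := bell_gt0 k (- h).
  by move=> ? ? ? ?; have := ler_norm (layer k h);
    have := ler_norm (- layer k (- h)); rewrite normrN; lra.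
- by lra.
- exact: continuous_subspaceT.
- split => [y _||]; first by case: (is_derive_layer k y).
  + exact/cvg_at_right_filter/cl.
  + exact/cvg_at_left_filter/cl.
- by move=> y _; rewrite derive1E; case: (is_derive_layer k y).
Qed.

Lemma energy_profile (R : realType) (a : 'cV[R]_2) (W : 'M[R]_2 -> R)
    (c eps l r h : R) (u : H2 (cylinder `]l, r[%classic h)) :
  0 < c -> 0 < eps -> l < r -> 0 < h ->
  (forall M, 0 <= W M) -> continuous W ->
  (forall M, W M <= c ^+ 2 * W0 a M) ->
  H2_grad u = (fun x => layer (c / eps) x.2 *: tensor a (e2 R)) ->
  H2_hess u = (fun x m => (c / eps * bell (c / eps) x.2) *:
                 ((m == 1)%:R *: tensor a (e2 R))) ->
  (energy W eps u <= ((r - l) * (2 * c * enorm a ^+ 2))%:E)%E.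
Proof.
move=> c0 eps0 lr h0 W_ge0 W_cont WW0 gradE hessE.
set k := c / eps in gradE hessE; have k0 : 0 < k by rewrite divr_gt0.
pose A := tensor a (e2 R); pose al := enorm a ^+ 2.
pose f (y : R) := eps^-1 * W (layer k y *: A) + eps * ((k * bell k y) ^+ 2 * al).
have al0 : 0 <= al by exact: sqr_ge0.
have f0 y : 0 <= f y.
  apply: addr_ge0; apply: mulr_ge0; [by rewrite invr_ge0 ltW|exact: W_ge0|exact: ltW|].
  by apply: mulr_ge0 => //; exact: sqr_ge0.
have cb : continuous (bell k) by exact: continuous_bell.
have cf : continuous f.
  move=> y; apply: cvgD; apply: cvgMr.
    apply: (@continuous_comp _ _ _ (fun y => layer k y *: A) W); last exact: W_cont.
    apply: cvgZr_tmp; exact: (is_derive1_continuous (is_derive_layer k)).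
  apply: cvgMl; apply: (@continuous_comp _ _ _ (fun y => k * bell k y) (fun t => t ^+ 2)).
    by apply: cvgMr; exact: cb.
  exact: exprn_continuous.
(* As eps k = c, each of the two terms is bounded by c^2 bell^2 |a|^2 / eps. Since bell^2 is the
   bell of rate 2k, their sum is c |a|^2 times the derivative of [layer (2 * k)], whose total
   increment is at most 2. *)
have fE y : f y <= c * al * (2 * k * bell (2 * k) y).
  have : eps^-1 * W (layer k y *: A) <= eps^-1 * (c ^+ 2 * ((bell k y) ^+ 2 * al)).
    rewrite ler_wpM2l ?invr_ge0 ?(ltW eps0)// (le_trans (WW0 _))//.
    rewrite ler_wpM2l ?sqr_ge0// (le_trans (W0_scale_tensor _ _))//.
    by rewrite normr_layer// opprB addrCA subrr addr0 exprMn.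
  move=> fW; rewrite /f (le_trans (lerD fW (lexx _)))// exprMn bell_sqr /k.
  rewrite le_eqVlt; apply/orP; left; apply/eqP; field.
  by rewrite gt_eqF.
have -> : energy W eps u =
    (\int[leb2 R]_(x in cylinder `]l, r[%classic h) (f x.2)%:E)%E.
  rewrite /energy gradE hessE; apply: eq_integral => x _; congr (_ + eps * _)%:E.
  rewrite !big_ord_recl big_ord0 !enormZ /= normr0 normr1 mul0r mulr0 mul1r.
  by rewrite expr0n add0r addr0 enorm_tensor_e2 exprMn real_normK ?num_real.
rewrite integral_cylinder_snd// EFinM; apply: lee_wpmul2l; first by rewrite lee_fin subr_ge0 ltW.
have k20 : 0 < 2 * k by rewrite mulr_gt0.
have ck20 : continuous (fun y => 2 * k * bell (2 * k) y).
  by move=> y; apply: cvgMr; exact: continuous_bell.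
apply: (@le_trans _ _ (\int[@lebesgue_measure R]_(y in `](- h)%R, h[)
    ((c * al)%:E * (2 * k * bell (2 * k) y)%:E))%E).
  apply: ge0_le_integral => //.
  - by move=> y _; rewrite lee_fin.
  - by apply/measurable_EFinP/measurable_funTS; exact: continuous_measurable_fun.
  - apply: emeasurable_funM => //.
    by apply/measurable_EFinP/measurable_funTS; exact: continuous_measurable_fun.
  - by move=> y _; rewrite -EFinM lee_fin.
rewrite ge0_integralZl//=; last 3 first.
- by apply/measurable_EFinP/measurable_funTS; exact: continuous_measurable_fun.
- by move=> y _; rewrite lee_fin mulr_ge0 ?(ltW k20)// ltW// bell_gt0.
- by rewrite lee_fin mulr_ge0// ltW.
apply: (le_trans (lee_wpmul2l _ (integral_bell k20 h0))).
  by rewrite lee_fin mulr_ge0// ltW.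
by rewrite -EFinM lee_fin le_eqVlt; apply/orP; left; apply/eqP; rewrite /al; ring.
Qed.

Lemma cvg_L1_profile (R : realType) (a : 'cV[R]_2) (l r h : R) (k : nat -> R)
    (u : nat -> R * R -> 'cV[R]_2) :
  l < r -> 0 < h -> (forall n, 0 < k n) -> (k n)^-1 @[n --> \oo] --> 0 ->
  (forall n, u n = fun x => rounded_abs (k n) x.2 *: a) ->
  cvg_L1 (cylinder `]l, r[%classic h) u
    (u0 (tensor a (e2 R)) (- tensor a (e2 R))).
Proof.
move=> lr h0 k0 kV uE; rewrite /cvg_L1; set O := cylinder _ _.
have mO : measurable (O : set (measurableTypeR R * measurableTypeR R)).
  exact: measurable_cylinder.
pose B := (r - l) * (2 * h) * enorm a.
(* With B = -A the reference map is |x_2| a, so only the exponential correction, at most |a|/k,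
   remains. *)
have distE n x : enorm (u n x - u0 (tensor a (e2 R)) (- tensor a (e2 R)) x) =
    bell (k n) x.2 / k n * enorm a.
  have -> : u0 (tensor a (e2 R)) (- tensor a (e2 R)) x = `|x.2| *: a.
    rewrite /u0 mulNmx tensor_e2_vec; case: ltrP => x0.
      by rewrite gtr0_norm.
    by rewrite ler0_norm// scaleNr.
  rewrite uE -scalerBl enormZ rounded_absE addrAC subrr add0r ger0_norm//.
  by rewrite divr_ge0// ltW// bell_gt0.
apply: (@squeeze_cvge _ _ _ _ (cst 0%E) _ (fun n => (B * (k n)^-1)%:E)).
- apply: nearW => n; apply/andP; split.
    by apply: integral_ge0 => x _; rewrite lee_fin sqrtr_ge0.
  under eq_integral do rewrite distE.
  have -> : ((B * (k n)^-1)%:E =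
      \int[leb2 R]_(x in O) cst (enorm a / k n)%:E x)%E.
    rewrite integral_cst// leb2_cylinder// -EFinM; congr (_%:E); rewrite /B.
    by ring.
  apply: ge0_le_integral => //.
  + by move=> x _; rewrite lee_fin !mulr_ge0 ?invr_ge0 ?sqrtr_ge0// ltW// bell_gt0.
  + apply/measurable_EFinP/measurable_funTS; apply: continuous_measurable_prod.
    move=> x; do 2 apply: cvgMl; apply: continuous_comp; first exact: cvg_snd.
    exact: continuous_bell.
  + move=> x _; rewrite lee_fin (mulrC (enorm a)) -mulrA ler_piMl ?bell_le1//.
    by rewrite mulr_ge0 ?sqrtr_ge0// invr_ge0 ltW.
- exact: cvg_cst.
- by apply: cvg_EFin; [exact: nearW|rewrite -[X in _ --> X](mulr0 B); exact: cvgMr].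
Qed.

Lemma Kstar_le (R : realType) (a : 'cV[R]_2) (W : 'M[R]_2 -> R) (c h : R) :
  0 < c -> 0 < h -> (forall M, 0 <= W M) -> continuous W ->
  (forall M, W M <= c ^+ 2 * W0 a M) ->
  (Kstar W (tensor a (e2 R)) (- tensor a (e2 R)) h <=
   (2 * c * enorm a ^+ 2)%:E)%E.
Proof.
move=> c0 h0 W_ge0 W_cont WW0.
have lr : - 2^-1 < 2^-1 :> R by lra.
pose eps (n : nat) : R := n.+1%:R^-1.
have eps0 n : 0 < eps n by rewrite invr_gt0.
have k0 n : 0 < c / eps n by rewrite divr_gt0.
have [u uP] := choice (fun n => profile_H2 a (k0 n) lr h0).
have energy_le n : (energy W (eps n) (u n) <= (2 * c * enorm a ^+ 2)%:E)%E.
  have [_ gE sE] := uP n.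
  rewrite (le_trans (energy_profile c0 (eps0 n) lr h0 W_ge0 W_cont WW0 gE sE))//.
  by rewrite (_ : _ - _ = 1) ?mul1r//; lra.
apply: (@le_trans _ _ (limn_einf (fun n => energy W (eps n) (u n)))).
  apply: ereal_inf_lbound; exists eps, u; split=> //.
  - exact: cvg_harmonic.
  - apply: (@cvg_L1_profile _ _ _ _ _ (fun n => c / eps n)) => //.
    + under eq_fun do rewrite invf_div.
      have : eps n / c @[n --> \oo] --> 0 / c by apply: cvgMl; exact: cvg_harmonic.
      by rewrite mul0r.
    + by move=> n; case: (uP n).
(* Each tail infimum is at most the first term of its tail, so the uniform energy bound passes to
   the limit inferior. *)
rewrite limn_einf_lim; apply: lime_le; first exact: is_cvg_einfs.
apply: nearW => n; apply: (@le_trans _ _ (energy W (eps n) (u n))) => //.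
by apply: ereal_inf_lbound; exists n => /=.
Qed.

(** * Increments of a weakly differentiable function *)

(** Heine-Cantor for continuity relative to [K], as a competitor is arbitrary outside [-1, 1]. The
    near-covering form of compactness yields one radius for all points. *)
Lemma within_compact_unif_continuous (R : realType) (K : set R) (p : R -> R) :
  compact K -> {within K, continuous p} -> forall d : R, 0 < d ->
  exists2 r : R, 0 < r &
    forall x y, K x -> K y -> `|x - y| < r -> `|p x - p y| < d.
Proof.
move=> cK cp d d0.
pose P (r x : R) := K x -> forall y, K y -> `|x - y| < r -> `|p x - p y| < d.
have : \forall r \near (0 : R)^'+, K `<=` P r.
  apply: ((compact_near_coveringP K).1 cK R (0 : R)^'+ P _) => x Kx.
  have d20 : 0 < d / 2 by rewrite divr_gt0.
  have /subspace_continuousP/(_ x Kx)/cvgrPdist_lt/(_ _ d20) := cp.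
  rewrite near_withinE => /nbhs_ballP[e /= e0 eP].
  have e20 : 0 < e / 2 by rewrite divr_gt0.
  exists (ball x (e / 2), [set r | r < e / 2]) => /=.
    by split; [exact: nbhsx_ballx|exact: nbhs_right_lt].
  case=> x' r /= [+ re] Kx' y Ky x'y; rewrite /ball /= => xx'.
  have px' : `|p x - p x'| < d / 2.
    by apply: eP => //; rewrite /ball /= (lt_trans xx')//; lra.
  have py : `|p x - p y| < d / 2.
    apply: eP => //; rewrite /ball /= -(subrKA x').
    by rewrite (le_lt_trans (ler_normD _ _))//; lra.
  rewrite distrC in px'; rewrite -(subrKA (p x)).
  by rewrite (le_lt_trans (ler_normD _ _))//; lra.
move=> rP; near (0 : R)^'+ => r.
exists r => // x y Kx Ky; have : K `<=` P r by near: r.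
by apply.
Unshelve. all: by end_near. Qed.

(** * Piecewise quadratic test functions of class C^1 *)

Definition ramp2 (R : realType) (x : R) : R := if 0 < x then x ^+ 2 else 0.

Lemma is_derive_ramp2 (R : realType) (x : R) :
  is_derive x 1 (@ramp2 R) (`|x| + x).
Proof.
rewrite (_ : _ + _ = if 0 < x then 2 * x else 0); last first.
  by case: ltrP => x0; [rewrite gtr0_norm// mulrDl mul1r|rewrite ler0_norm// addNr].
apply: (@is_derive_piecewise _ (fun y => y ^+ 2) (cst 0) (fun y => 2 * y) (cst 0)).
- by move=> y; apply: is_derive_eq; rewrite /GRing.scale/=; ring.
- by rewrite /cst expr0n.
- by rewrite mulr0.
Qed.

(** Half the second difference of [ramp2]: a C^1 quadratic spline rising from 0 at x = 0 to 1 at x =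
    2. *)
Definition smooth_step (R : realType) (x : R) : R :=
  (ramp2 x - 2 * ramp2 (x - 1) + ramp2 (x - 2)) / 2.

(* The derivative of [smooth_step], with [2 max(x, 0)] written as [|x| + x]. *)
Definition tent (R : realType) (x : R) : R :=
  ((`|x| + x) - 2 * (`|x - 1| + (x - 1)) + (`|x - 2| + (x - 2))) / 2.

Lemma tent_ge0 (R : realType) (x : R) : 0 <= tent x.
Proof.
by rewrite /tent; case: (ger0P x); case: (ger0P (x - 1)); case: (ger0P (x - 2)) => *; lra.
Qed.

Lemma tent_eq0 (R : realType) (x : R) : ~~ (0 <= x <= 2) -> tent x = 0.
Proof.
rewrite negb_and -!ltNge => /orP x02; rewrite /tent.
by case: (ger0P x); case: (ger0P (x - 1)); case: (ger0P (x - 2)) => *;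
  case: x02 => ?; lra.
Qed.

Lemma continuous_tent (R : realType) : continuous (@tent R).
Proof.
have cs (b : R) : continuous (fun x : R => `|x - b| + (x - b)).
  move=> x; have cb : {for x, continuous (fun x : R => x - b)}.
    by apply: cvgB; [exact: cvg_id|exact: cvg_cst].
  apply: cvgD => //; apply: (continuous_comp cb); exact: norm_continuous.
move=> x; apply: cvgMl; apply: cvgD; last exact: cs.
apply: cvgB; last by apply: cvgMr; exact: cs.
by apply: cvgD; [exact: norm_continuous|exact: cvg_id].
Qed.

Lemma smooth_step_le0 (R : realType) (x : R) : x <= 0 -> smooth_step x = 0.
Proof.
move=> x0; rewrite /smooth_step /ramp2; case: ltrP => ?; first lra.
by case: ltrP => ?; first lra; case: ltrP => ?; lra.
Qed.

Lemma smooth_step_ge2 (R : realType) (x : R) : 2 <= x -> smooth_step x = 1.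
Proof.
move=> x0; rewrite /smooth_step /ramp2; case: ltrP => ?; last lra.
by case: ltrP => ?; last lra; case: ltrP => ?; last (have -> : x = 2 by lra); lra.
Qed.

Lemma smooth_step_bounds (R : realType) (x : R) : 0 <= smooth_step x <= 1.
Proof.
rewrite /smooth_step /ramp2; case: ltrP => ?; case: ltrP => ?; case: ltrP => ?;
  by apply/andP; split; nra.
Qed.

Lemma is_derive_smooth_step_affine (R : realType) (m b x : R) :
  is_derive x 1 (fun y : R => smooth_step (m * y + b)) (m * tent (m * x + b)).
Proof.
have dl (c : R) : is_derive x 1 (fun y : R => m * y + b - c) m.
  have := is_deriveD (is_deriveZ m (is_derive_id x (1 : R)))
    (is_derive_cst (b - c) x (1 : R)).
  rewrite /= /GRing.scale/= mulr1 addr0; congr is_derive.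
  by apply/funext => y /=; rewrite addrA.
have dr c : is_derive x 1 (fun y : R => ramp2 (m * y + b - c))
    ((`|m * x + b - c| + (m * x + b - c)) * m).
  by apply: (@is_derive1_comp R (@ramp2 R) (fun y => m * y + b - c));
    exact: is_derive_ramp2.
have d0 := dr 0; have d1 := dr 1; have d2 := dr 2.
rewrite (_ : (fun y => _) = fun y => (ramp2 (m * y + b - 0)
  - 2 * ramp2 (m * y + b - 1) + ramp2 (m * y + b - 2)) / 2); last first.
  by apply/funext => y; rewrite subr0.
by apply: is_derive_eq; rewrite /GRing.scale/= /tent subr0; ring.
Qed.

Lemma C1c_is_derive (R : realType) (O : set R) (eta deta : R -> R) (a b : R) :
  (forall x : R, is_derive x 1 eta (deta x)) -> continuous deta ->
  `[a, b]%classic `<=` O -> (forall x, ~~ (a <= x <= b) -> eta x = 0) ->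
  @C1c R R O eta.
Proof.
move=> de cde abO eta0.
have diffeta x : differentiable eta x.
  by apply/derivable1_diffP; case: (de x).
split=> // [v|].
  rewrite (_ : 'D_v eta = fun x => v * deta x).
    by move=> x; apply: cvgMr; exact: cde.
  apply/funext => x; rewrite deriveE// diff1E// derive1E.
  by case: (de x) => _ ->.
exists `[a, b]%classic; split=> //; first exact: segment_compact.
by move=> x /= xab; apply: eta0; apply/negP => h; apply: xab; rewrite in_itv.
Qed.

(** The condition [W11_derP] for one real function, so that it applies to linear combinations of
    matrix entries. *)
Definition weak_der (R : realType) (p psi : R -> R) :=
  forall eta : R -> R, @C1c R R `]-1, 1[%classic eta ->
    (\int[@lebesgue_measure R]_(s in `](-1)%R, 1%R[) (p s * derive1 eta s)%:E
     = - \int[@lebesgue_measure R]_(s in `](-1)%R, 1%R[) (psi s * eta s)%:E)%E.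

Section bump.
Variables (R : realType) (s t m : R).
Hypotheses (st : s < t) (m0 : 0 < m) (mst : 6 <= m * (t - s)).

(** Rises on [s + 1/m, s + 3/m] and falls on [t - 3/m, t - 1/m]. The bound 6 <= m (t - s) makes the
    rise end before the fall begins; the margin 1/m keeps the support inside the open interval, even
    for s = -1 or t = 1. *)
Definition bump (x : R) : R :=
  smooth_step (m * x + (- m * s - 1)) - smooth_step (m * x + (- m * t + 3)).

Lemma is_derive_bump (x : R) : is_derive x 1 bump
  (m * tent (m * x + (- m * s - 1)) - m * tent (m * x + (- m * t + 3))).
Proof.
by apply: is_deriveB; exact: is_derive_smooth_step_affine.
Qed.

Lemma bump_bounds (x : R) : 0 <= bump x <= 1.
Proof.
rewrite /bump; have /andP[? ?] := smooth_step_bounds (m * x + (- m * s - 1)).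
have /andP[? ?] := smooth_step_bounds (m * x + (- m * t + 3)).
have [h|h] := leP (m * x + (- m * t + 3)) 0.
  by rewrite (smooth_step_le0 h); apply/andP; split; lra.
have h2 : 2 <= m * x + (- m * s - 1) by have := mst; rewrite mulrBr => ?; lra.
by rewrite (smooth_step_ge2 h2); apply/andP; split; lra.
Qed.

Lemma bump_eq0 (x : R) : ~~ (s + m^-1 <= x <= t - m^-1) -> bump x = 0.
Proof.
have mV : m * m^-1 = 1 by rewrite divff// gt_eqF.
have := mst; rewrite mulrBr => mst'; rewrite negb_and -!ltNge /bump => /orP[h|h].
  have : m * x < m * (s + m^-1) by rewrite ltr_pM2l.
  rewrite mulrDr mV => xs.
  by rewrite smooth_step_le0 ?smooth_step_le0 ?subrr//; lra.
have : m * (t - m^-1) < m * x by rewrite ltr_pM2l.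
rewrite mulrBr mV => xt.
by rewrite smooth_step_ge2 ?smooth_step_ge2 ?subrr//; lra.
Qed.

Lemma C1c_bump (th : R) : -1 <= s -> t <= 1 ->
  @C1c R R `]-1, 1[%classic (fun x => th * bump x).
Proof.
move=> s1 t1; have mV : 0 < m^-1 by rewrite invr_gt0.
apply: (@C1c_is_derive _ _ _
  (fun x => th * (m * tent (m * x + (- m * s - 1)) - m * tent (m * x + (- m * t + 3))))
  (s + m^-1) (t - m^-1)).
- by move=> x; exact: (is_deriveZ th (is_derive_bump x)).
- have ct b : continuous (fun x : R => m * tent (m * x + b)).
    move=> x; apply: cvgMr.
    apply: (@continuous_comp _ _ _ (fun x => m * x + b) (@tent R)).
      by apply: cvgD; [apply: cvgMr; exact: cvg_id|exact: cvg_cst].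
    exact: continuous_tent.
  by move=> x; apply: cvgMr; apply: cvgB; exact: ct.
- by move=> x /=; rewrite !in_itv/= => /andP[? ?]; apply/andP; split; lra.
- by move=> x /bump_eq0 ->; rewrite mulr0.
Qed.

End bump.

Lemma bump_window (R : realType) (m s r x : R) : 0 < m -> 3 < m * r ->
  tent (m * x + (- m * s - 1)) != 0 -> `|x - s| < r.
Proof.
move=> m0 mr tn0; have /andP[h1 h2] : 0 <= m * x + (- m * s - 1) <= 2.
  by apply: contraNT tn0 => /tent_eq0 ->.
rewrite -(ltr_pM2l m0) (_ : m * `|_| = `|m * x - m * s|); last first.
  by rewrite -mulrBr normrM gtr0_norm.
by rewrite ltr_norml; apply/andP; split; lra.
Qed.

Lemma bump_window_shift (R : realType) (m t r x : R) : 0 < m -> 3 < m * r ->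
  tent (m * x + (- m * t + 3)) != 0 -> `|x - t| < r.
Proof.
move=> m0 mr tn0; have /andP[h1 h2] : 0 <= m * x + (- m * t + 3) <= 2.
  by apply: contraNT tn0 => /tent_eq0 ->.
rewrite -(ltr_pM2l m0) (_ : m * `|_| = `|m * x - m * t|); last first.
  by rewrite -mulrBr normrM gtr0_norm.
by rewrite ltr_norml; apply/andP; split; lra.
Qed.

(** Each kernel [m * tent] has mass one, carried by a window inside (-1, 1) next to [s] or [t]. *)
Lemma integral_bump_parts (R : realType) (s t m c1 c2 : R) :
  -1 <= s -> t <= 1 -> 0 < m -> s < t -> 6 <= m * (t - s) ->
  (\int[@lebesgue_measure R]_(x in `](-1)%R, 1%R[)
    (c1 * (m * tent (m * x + (- m * s - 1)))
     - c2 * (m * tent (m * x + (- m * t + 3))))%:E = (c1 - c2)%:E)%E.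
Proof.
move=> s1 t1 m0 st mst.
have ct b c : continuous (fun x : R => c * (m * tent (m * x + b))).
  move=> x; do 2 apply: cvgMr.
  apply: (@continuous_comp _ _ _ (fun x => m * x + b) (@tent R)).
    by apply: cvgD; [apply: cvgMr; exact: cvg_id|exact: cvg_cst].
  exact: continuous_tent.
have cL : continuous (fun x => c1 * (m * tent (m * x + (- m * s - 1)))
     - c2 * (m * tent (m * x + (- m * t + 3)))).
  by move=> x; apply: cvgB; exact: ct.
pose F x := c1 * smooth_step (m * x + (- m * s - 1))
  - c2 * smooth_step (m * x + (- m * t + 3)).
have dF (x : R) : is_derive x 1 F (c1 * (m * tent (m * x + (- m * s - 1)))
     - c2 * (m * tent (m * x + (- m * t + 3)))).
  by apply: is_deriveB; apply: is_deriveZ; exact: is_derive_smooth_step_affine.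
have cF := is_derive1_continuous dF.
rewrite -(@integral_itv_bndoo _ _ _ _ true false); last first.
  by apply/measurable_EFinP/measurable_funTS; exact: continuous_measurable_fun.
rewrite (@continuous_FTC2 _ _ F).
- have := mst; rewrite mulrBr => mst'.
  have ms : 0 <= m * (s + 1) by rewrite mulr_ge0//; lra.
  have mt : 0 <= m * (1 - t) by rewrite mulr_ge0//; lra.
  have F1 : F 1 = c1 - c2.
    by rewrite /F smooth_step_ge2 ?smooth_step_ge2; lra.
  have FN1 : F (-1) = 0.
    by rewrite /F smooth_step_le0 ?smooth_step_le0; lra.
  by rewrite F1 FN1 sube0.
- by lra.
- exact: continuous_subspaceT.
- split => [x _||]; first by case: (dF x).
  + exact/cvg_at_right_filter/cF.
  + exact/cvg_at_left_filter/cF.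
- by move=> x _; rewrite derive1E; case: (dF x).
Qed.

(* Testing with the bump supported in [s, t] gives, up to the oscillation of
   [p], the increment of [p] on the left and at most the integral of [|psi|] on
   the right. *)
Lemma weak_der_increment (R : realType) (p psi : R -> R) (s t : R) :
  {within `[-1, 1]%classic, continuous p} ->
  (@lebesgue_measure R).-integrable `[-1, 1]%classic (EFin \o psi) ->
  weak_der p psi -> -1 <= s -> s < t -> t <= 1 ->
  (`|p s - p t|%:E <= \int[@lebesgue_measure R]_(x in `[s, t]) `|psi x|%:E)%E.
Proof.
move=> cp ipsi ppsi s1 st t1; apply/lee_addgt0Pr => d d0.
have d20 : 0 < d / 2 by rewrite divr_gt0.
have [r r0 pr] := within_compact_unif_continuous (@segment_compact _ _ _) cp d20.
have ts0 : 0 < t - s by lra.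
(* The first summand separates the rise from the fall; the second gives m r > 3, so both windows lie
   within [r] of the endpoints. *)
pose m := 6 / (t - s) + 4 / r.
have m0 : 0 < m by rewrite addr_gt0// divr_gt0.
have mst : 6 <= m * (t - s).
  rewrite /m mulrDl divfK ?gt_eqF// lerDl.
  by rewrite ltW// mulr_gt0 ?divr_gt0.
have mr : 3 < m * r.
  rewrite /m mulrDl divfK ?gt_eqF//.
  have : 0 < 6 / (t - s) * r by rewrite mulr_gt0 ?divr_gt0.
  by lra.
pose th : R := if 0 <= p s - p t then 1 else -1.
have thE : `|p s - p t| = th * (p s - p t).
  by rewrite /th; case: ger0P; rewrite (mul1r, mulN1r).
have th1 : `|th| = 1 by rewrite /th; case: ifP; rewrite ?normrN normr1.
pose K1 (x : R) : R := m * tent (m * x + (- m * s - 1)).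
pose K2 (x : R) : R := m * tent (m * x + (- m * t + 3)).
pose eta (x : R) : R := th * bump s t m x.
have etaC : @C1c R R `]-1, 1[%classic eta by exact: C1c_bump.
have detaE x : derive1 eta x = th * (K1 x - K2 x).
  by rewrite derive1E; case: (is_deriveZ th (is_derive_bump s t m x)).
have cK b : continuous (fun x : R => m * tent (m * x + b)).
  move=> x; apply: cvgMr.
  apply: (@continuous_comp _ _ _ (fun x => m * x + b) (@tent R)).
    by apply: cvgD; [apply: cvgMr; exact: cvg_id|exact: cvg_cst].
  exact: continuous_tent.
have ceta : continuous eta.
  exact: (is_derive1_continuous (fun x => is_deriveZ th (is_derive_bump s t m x))).
have oosub : (`]-1, 1[%classic : set R) `<=` `[-1, 1]%classic.
  exact: subset_itv_oo_cc.
(* A lower bound for p eta': on each window th p is replaced by its endpoint value, shifted by d/2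
   in the unfavourable direction. The sign [th] makes its integral |p s - p t| - d. *)
pose L (x : R) : R := (th * p s - d / 2) * K1 x - (th * p t + d / 2) * K2 x.
have cL : continuous L.
  by move=> x; apply: cvgB; apply: cvgMr; exact: cK.
have intL : (\int[@lebesgue_measure R]_(x in `](-1)%R, 1%R[) (L x)%:E =
    (`|p s - p t| - d)%:E)%E.
  by rewrite integral_bump_parts//; congr (_%:E); rewrite thE; lra.
have Lle x : -1 <= x <= 1 -> L x <= p x * derive1 eta x.
  move=> x11; have xI : `[-1, 1]%classic x by rewrite /= in_itv.
  have sI : `[-1, 1]%classic s by rewrite /= in_itv/=; apply/andP; split; lra.
  have tI : `[-1, 1]%classic t by rewrite /= in_itv/=; apply/andP; split; lra.
  have dist y : `|p x - p y| < d / 2 -> `|th * p x - th * p y| < d / 2.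
    by rewrite -mulrBr normrM th1 mul1r.
  have le1 : (th * p s - d / 2) * K1 x <= th * p x * K1 x.
    have [K0|Kn0] := eqVneq (tent (m * x + (- m * s - 1))) 0.
      by rewrite /K1 K0 !mulr0.
    have /(pr _ _ xI sI)/dist := bump_window m0 mr Kn0.
    rewrite ltr_norml => /andP[h _]; apply: ler_wpM2r; last by lra.
    by rewrite mulr_ge0 ?tent_ge0// ltW.
  have le2 : th * p x * K2 x <= (th * p t + d / 2) * K2 x.
    have [K0|Kn0] := eqVneq (tent (m * x + (- m * t + 3))) 0.
      by rewrite /K2 K0 !mulr0.
    have /(pr _ _ xI tI)/dist := bump_window_shift m0 mr Kn0.
    rewrite ltr_norml => /andP[_ h]; apply: ler_wpM2r; last by lra.
    by rewrite mulr_ge0 ?tent_ge0// ltW.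
  by rewrite /L detaE mulrA [p x * th]mulrC mulrBr lerB.
have iL : (@lebesgue_measure R).-integrable `]-1, 1[%classic (EFin \o L).
  have iC : (@lebesgue_measure R).-integrable `[-1, 1]%classic (EFin \o L).
    apply: continuous_compact_integrable; first exact: segment_compact.
    exact: continuous_subspaceT.
  by apply: integrableS iC => //; exact: measurable_itv.
have ip : (@lebesgue_measure R).-integrable `]-1, 1[%classic
    (EFin \o (fun x => p x * derive1 eta x)).
  have iC : (@lebesgue_measure R).-integrable `[-1, 1]%classic
      (EFin \o (fun x => p x * derive1 eta x)); last first.
    by apply: integrableS iC => //; exact: measurable_itv.
  apply: continuous_compact_integrable; first exact: segment_compact.
  move=> x; apply: cvgM; first exact: cp.
  rewrite (_ : derive1 eta = fun x => th * (K1 x - K2 x)); last exact/funext.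
  apply: (@continuous_subspaceT _ _ _ (fun x => th * (K1 x - K2 x))) => y.
  by apply: cvgMr; apply: cvgB; exact: cK.
have mpsi : measurable_fun (`[-1, 1]%classic : set (measurableTypeR R)) psi.
  by apply/measurable_EFinP; exact: measurable_int ipsi.
have mpe : measurable_fun (`[-1, 1]%classic : set (measurableTypeR R)) (fun x => (psi x * eta x)%:E).
  apply/measurable_EFinP; apply: measurable_funM => //.
  by apply: measurable_funTS; exact: continuous_measurable_fun.
have : ((`|p s - p t| - d)%:E <=
    \int[@lebesgue_measure R]_(x in `](-1)%R, 1%R[) (p x * derive1 eta x)%:E)%E.
  rewrite -intL; apply: le_integral => // x; rewrite inE/= in_itv/= => /andP[? ?].
  by rewrite lee_fin Lle//; apply/andP; split; exact: ltW.
rewrite ppsi// => le1.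
rewrite -leeBlDr// -EFinB (le_trans le1)//.
apply: (le_trans (lee_abs _)); rewrite abseN.
apply: (le_trans (le_abse_integral _ _ _)) => //; first exact: measurable_funS mpe.
apply: (@le_trans _ _ (\int[@lebesgue_measure R]_(x in `[(-1)%R, 1%R])
    `|(psi x * eta x)%:E|)%E).
  apply: ge0_subset_integral => //; exact: measurableT_comp.
have -> : (\int[@lebesgue_measure R]_(x in `[(-1)%R, 1%R]) `|(psi x * eta x)%:E| =
    \int[@lebesgue_measure R]_(x in `[s, t]) `|(psi x * eta x)%:E|)%E.
  have -> : `[s, t]%classic = `[-1, 1]%classic `&` `[s, t]%classic :> set R.
    apply/esym/setIidPr => x /=; rewrite !in_itv/= => /andP[? ?].
    by apply/andP; split; lra.
  rewrite integral_mkcondr; apply: eq_integral => x _; rewrite patchE.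
  case: ifPn => // /negP; rewrite inE/= in_itv/= => xst.
  suff b0 : bump s t m x = 0 by rewrite /eta b0 !mulr0 /= normr0.
  apply: bump_eq0 => //; apply/negP => /andP[? ?]; apply: xst.
  have mV0 : 0 < m^-1 by rewrite invr_gt0.
  by apply/andP; split; lra.
have stsub : `[s, t]%classic `<=` `[-1, 1]%classic.
  by move=> x /=; rewrite !in_itv/= => /andP[? ?]; apply/andP; split; lra.
apply: ge0_le_integral => //.
- by apply: measurableT_comp => //; exact: measurable_funS mpe.
- apply/measurable_EFinP; apply: measurableT_comp => //.
  exact: measurable_funS mpsi.
- move=> x _; rewrite -abse_EFin lee_fin normrM normrM th1 mul1r.
  have /andP[b0 b1] := bump_bounds mst x.
  by rewrite ler_piMr// ger0_norm.
Qed.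

(** * The lower bound on the geodesic distance *)

(* A primitive of [1 - |x|]. *)
Definition weight_prim (R : realType) (x : R) : R := x - x * `|x| / 2.

(** A mean value inequality with the slope frozen at a third point: between [x] and [y] the slope
    differs from 1 - |z| by at most [d]. *)
Lemma weight_prim_dist (R : realType) (x y z d : R) :
  `|x - z| <= d -> `|y - z| <= d ->
  `|weight_prim x - weight_prim y| <= (`|1 - `|z| | + d) * `|x - y|.
Proof.
wlog xy : x y / y <= x.
  move=> h hx hy; have [yx|/ltW xy] := leP y x; first exact: h.
  by rewrite distrC (distrC x); exact: h.
move=> xz yz.
(* The left side is the integral of |w| - |z| for w from [y] to [x], where |w - z| <= d. *)
have key : `|(x * `|x| - y * `|y|) / 2 - `|z| * (x - y)| <= d * (x - y).
  move: xz yz; rewrite !ler_norml => /andP[? ?] /andP[? ?].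
  apply/andP; split; case: (ger0P x); case: (ger0P y); case: (ger0P z) => *; nra.
rewrite (ger0_norm (_ : 0 <= x - y)) ?subr_ge0// mulrDl.
have -> : weight_prim x - weight_prim y =
    (1 - `|z|) * (x - y) - ((x * `|x| - y * `|y|) / 2 - `|z| * (x - y)).
  by rewrite /weight_prim; field.
rewrite (le_trans (ler_normB _ _))// lerD// normrM.
by rewrite (ger0_norm (_ : 0 <= x - y)) ?subr_ge0.
Qed.

(** The shared endpoint [u] is a null set. *)
Lemma ge0_integral_itv_split (R : realType) (s u t : R) (f : R -> \bar R) :
  s < u -> u < t ->
  measurable_fun (`[s, t]%classic : set (measurableTypeR R)) f ->
  (forall x, (0 <= f x)%E) ->
  (\int[@lebesgue_measure R]_(x in `[s, t]) f x =
   \int[@lebesgue_measure R]_(x in `[s, u]) f x +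
   \int[@lebesgue_measure R]_(x in `[u, t]) f x)%E.
Proof.
move=> su ut mf f0.
have E : `[s, t]%classic = `[s, u]%classic `|` `]u, t]%classic :> set R.
  apply/seteqP; split=> x /=; rewrite !in_itv/=.
    by move=> /andP[-> ->]; case: (leP x u); [left|right].
  by case=> /andP[? ?]; apply/andP; split; lra.
rewrite E ge0_integral_setU//=; first last.
- by apply/disj_setPS => x [] /=; rewrite !in_itv/= => /andP[_ xu] /andP[]; rewrite ltNge xu.
- by rewrite -E.
rewrite (@integral_itv_obnd_cbnd _ _ (BRight t))//.
by apply: measurable_funS mf => // x; rewrite E; right.
Qed.

Section weak_der_length.
Variables (R : realType) (p psi : R -> R).
Hypothesis cp : {within `[-1, 1]%classic, continuous p}.
Hypothesis ipsi :
  (@lebesgue_measure R).-integrable `[-1, 1]%classic (EFin \o psi).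
Hypothesis ppsi : weak_der p psi.

Let mu := @lebesgue_measure R.
Let I : set (measurableTypeR R) := `[-1, 1]%classic.

Let mI : measurable I. Proof. exact: measurable_itv. Qed.

Let mpsi : measurable_fun I psi.
Proof. by apply/measurable_EFinP; exact: measurable_int ipsi. Qed.

Let mp : measurable_fun I p.
Proof. exact: subspace_continuous_measurable_fun. Qed.

Let F (d : R) (x : R) : R := (`|1 - `|p x| | + d) * `|psi x|.

Let mW : measurable_fun I (fun x => `|1 - `|p x| |).
Proof.
apply: measurableT_comp => //; apply: measurable_funB => //.
exact: measurableT_comp.
Qed.

Let mpsi1 : measurable_fun I (fun x => `|psi x|).
Proof. exact: measurableT_comp. Qed.

Let mF d : measurable_fun I (F d).
Proof.
apply: measurable_funM => //; apply: measurable_funD => //.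
Qed.

Let F0 d x : 0 <= d -> 0 <= F d x.
Proof. by move=> d0; rewrite mulr_ge0// addr_ge0. Qed.

(* Bisecting [s, t] [n] times leaves pieces shorter than the modulus of
   continuity [r], on which the weight is nearly constant. *)
Lemma weight_prim_increment (d r : R) : 0 <= d -> 0 < r ->
  (forall x y, I x -> I y -> `|x - y| < r -> `|p x - p y| < d) ->
  forall n (s t : R), -1 <= s -> s < t -> t <= 1 -> t - s < 2 ^+ n * r ->
  (`|weight_prim (p s) - weight_prim (p t)|%:E
    <= \int[mu]_(x in `[s, t]) (F d x)%:E)%E.
Proof.
move=> d0 r0 pr; elim=> [|n IH] s t s1 st t1; last first.
  rewrite exprS -mulrA => ts; pose u := (s + t) / 2.
  have su : s < u by rewrite /u; lra.
  have ut : u < t by rewrite /u; lra.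
  rewrite (@ge0_integral_itv_split _ s u t)//; last 2 first.
  - apply/measurable_EFinP; apply: measurable_funS (mF d) => // x.
    by rewrite /I /= !in_itv/= => /andP[? ?]; apply/andP; split; lra.
  - by move=> x; rewrite lee_fin F0.
  apply: (@le_trans _ _ (`|weight_prim (p s) - weight_prim (p u)|
      + `|weight_prim (p u) - weight_prim (p t)|)%:E).
    by rewrite lee_fin -(subrKA (weight_prim (p u))) ler_normD.
  by rewrite EFinD leeD// IH//; rewrite /u; lra.
rewrite expr0 mul1r => ts.
have [->|pst] := eqVneq (p s) (p t).
  by rewrite subrr normr0; apply: integral_ge0 => x _; rewrite lee_fin F0.
(* The chord slope of G is a constant below the enlarged weight at every point of the piece ([cF],
   with p x as the freezing point), so it can be moved inside the integral of |psi|. *)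
pose c := `|weight_prim (p s) - weight_prim (p t)| / `|p s - p t|.
have dp0 : 0 < `|p s - p t| by rewrite normr_gt0 subr_eq0.
have c0 : 0 <= c by rewrite divr_ge0.
have stI x : `[s, t]%classic x -> I x.
  by rewrite /I /= !in_itv/= => /andP[? ?]; apply/andP; split; lra.
have cF x : `[s, t]%classic x -> c <= `|1 - `|p x| | + d.
  move=> xst; rewrite ler_pdivrMr//; move: (xst); rewrite /= in_itv/= => /andP[sx xt].
  apply: weight_prim_dist; apply/ltW/pr; try exact: stI;
    try (by apply: stI; rewrite /= in_itv/= lexx ltW).
  - by rewrite distrC ger0_norm; lra.
  - by rewrite ger0_norm; lra.
have mpsist : measurable_fun (`[s, t]%classic : set (measurableTypeR R))
    (fun x => `|psi x|%:E).
  apply/measurable_EFinP; apply: measurableT_comp => //.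
  exact: measurable_funS mpsi.
apply: (@le_trans _ _ (c%:E * \int[mu]_(x in `[s, t]) `|psi x|%:E)%E).
  have -> : `|weight_prim (p s) - weight_prim (p t)| = c * `|p s - p t|.
    by rewrite divfK// gt_eqF.
  rewrite EFinM lee_wpmul2l// (weak_der_increment cp ipsi ppsi)//.
rewrite -ge0_integralZl//; apply: ge0_le_integral => //.
- by move=> x _; rewrite mule_ge0.
- exact: emeasurable_funM.
- by apply/measurable_EFinP; apply: measurable_funS (mF d).
- by move=> x /cF cx; rewrite -EFinM lee_fin ler_wpM2r.
Qed.

(** In place of the chain rule G(p)' = (1 - |p|) p', the increment estimate is applied on [-1, 1],
    where G(p) drops from 1/2 to -1/2, and [d] is sent to 0. *)
Lemma weak_der_weighted_length : p (-1) = 1 -> p 1 = -1 ->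
  (1 <= \int[mu]_(x in I) (`|1 - `|p x| | * `|psi x|)%:E)%E.
Proof.
move=> pN1 p1.
have /integrableP[_ psi_fin] := ipsi.
have psiE : (\int[mu]_(x in I) `|psi x|%:E)%E =
    (fine (\int[mu]_(x in I) `|psi x|%:E))%:E.
  rewrite fineK// ge0_fin_numE//; exact: integral_ge0.
set C := fine _ in psiE.
have C0 : 0 <= C by rewrite fine_ge0// integral_ge0.
apply/lee_addgt0Pr => e e0.
(* The extra weight costs d C <= e; adding 1 keeps the denominator positive. *)
pose d := e / (C + 1).
have d0 : 0 < d by rewrite divr_gt0// ltr_wpDl.
have [r r0 pr] := within_compact_unif_continuous (@segment_compact _ _ _) cp d0.
(* An [n] above 2/r suffices, as n < 2^n. *)
have [n nr] : exists n : nat, 1 - (-1) < 2 ^+ n * r.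
  have [n nr] : exists n : nat, 2 / r < n%:R.
    by exists (Num.bound (2 / r)); rewrite archi_boundP// divr_ge0// ltW.
  exists n; rewrite -ltr_pdivrMr//.
  rewrite (_ : 1 - -1 = 2 :> R); last by ring.
  by rewrite (lt_trans nr)// -natrX ltr_nat ltn_expl.
have := @weight_prim_increment d r (ltW d0) r0 pr n (-1) 1 (lexx _) _ (lexx _) nr.
rewrite pN1 p1 (_ : `|_| = 1); last first.
  rewrite /weight_prim normrN normr1 ger0_norm; lra.
move=> /(_ _)/le_trans; apply; first by lra.
rewrite /F; under eq_integral do rewrite mulrDl EFinD.
rewrite ge0_integralD//=; last 3 first.
- by apply/measurable_EFinP; exact: measurable_funM.
- by move=> x _; rewrite lee_fin mulr_ge0// ltW.
- by apply/measurable_EFinP; apply: measurable_funM.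
apply: leeD2l; under eq_integral do rewrite EFinM.
rewrite ge0_integralZl//=; last 2 first.
- exact/measurable_EFinP.
- by rewrite lee_fin ltW.
rewrite psiE -EFinM lee_fin /d mulrAC ler_pdivrMr ?ltr_wpDl//.
by rewrite ler_wpM2l ?lerDl// ltW.
Qed.

End weak_der_length.

(** * Projection of the second column onto [a] *)

Definition dot (R : realType) (v a : 'cV[R]_2) : R := \sum_i v i 0 * a i 0.

Lemma dotE (R : realType) (v a : 'cV[R]_2) :
  dot v a = v 0 0 * a 0 0 + v 1 0 * a 1 0.
Proof.
rewrite /dot !big_ord_recl big_ord0 addr0; congr (_ + v _ 0 * a _ 0);
  exact: val_inj.
Qed.

Lemma enorm_cV_sqr (R : realType) (v : 'cV[R]_2) :
  enorm v ^+ 2 = v 0 0 ^+ 2 + v 1 0 ^+ 2.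
Proof.
rewrite enorm_sqr !big_ord_recl !big_ord0 !addr0.
by congr (_ + v _ _ ^+ 2); exact: val_inj.
Qed.

Lemma enorm_ge0 (R : realType) m n (M : 'M[R]_(m, n)) : 0 <= enorm M.
Proof. exact: sqrtr_ge0. Qed.

Lemma dot_self (R : realType) (a : 'cV[R]_2) : dot a a = enorm a ^+ 2.
Proof. by rewrite dotE enorm_cV_sqr; ring. Qed.

Lemma dotDl (R : realType) (u v a : 'cV[R]_2) : dot (u + v) a = dot u a + dot v a.
Proof. by rewrite !dotE !mxE; ring. Qed.

Lemma dotNl (R : realType) (v a : 'cV[R]_2) : dot (- v) a = - dot v a.
Proof. by rewrite !dotE !mxE; ring. Qed.

Lemma dot_le (R : realType) (v a : 'cV[R]_2) : `|dot v a| <= enorm v * enorm a.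
Proof.
rewrite -ler_sqr ?nnegrE ?mulr_ge0 ?enorm_ge0//.
rewrite exprMn !enorm_cV_sqr real_normK ?num_real// dotE.
(* Lagrange's identity: the two sides differ by this square. *)
have := sqr_ge0 (v 0 0 * a 1 0 - v 1 0 * a 0 0); nra.
Qed.

Lemma enorm_gt0 (R : realType) (a : 'cV[R]_2) : a != 0 -> 0 < enorm a.
Proof.
move=> an0; rewrite lt_neqAle enorm_ge0 andbT eq_sym; apply: contra_neq an0 => a0.
have := enorm_cV_sqr a; rewrite a0 expr0n /= => /esym/eqP.
rewrite paddr_eq0 ?sqr_ge0// !sqrf_eq0 => /andP[/eqP a00 /eqP a10].
apply/colP => i; rewrite !mxE; have [->|i0] := eqVneq i 0; first by rewrite a00.
by rewrite (_ : i = 1)//; apply/val_inj; case: i i0 => -[|[]].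
Qed.

Lemma enorm_col_le (R : realType) (M : 'M[R]_2) (j : 'I_2) :
  enorm (col j M) <= enorm M.
Proof.
rewrite /enorm ler_wsqrtr// ler_sum// => i _; rewrite big_ord1 mxE.
by rewrite (bigD1 j)//= lerDl sumr_ge0// => k _; exact: sqr_ge0.
Qed.

Lemma enorm_ge_dot (R : realType) (v a : 'cV[R]_2) : a != 0 ->
  enorm a * `|dot v a / enorm a ^+ 2| <= enorm v.
Proof.
move=> /enorm_gt0 a0; rewrite normrM normfV [`|_ ^+ 2|]ger0_norm ?sqr_ge0//.
rewrite (_ : enorm a * _ = `|dot v a| / enorm a); last by field; rewrite gt_eqF.
by rewrite ler_pdivrMr// dot_le.
Qed.

(** Dropping the first column and projecting the second onto [a] can only shorten the distances to
    the wells; they become |a| |t - 1| and |a| |t + 1|, both at least |a| |1 - |t||. *)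
Lemma sqrt_W0_ge (R : realType) (a : 'cV[R]_2) (M : 'M[R]_2) : a != 0 ->
  enorm a * `|1 - `|dot (col 1 M) a / enorm a ^+ 2| | <= Num.sqrt (W0 a M).
Proof.
move=> an0; have a0 := enorm_gt0 an0; set t := dot _ _ / _.
rewrite -[leLHS]ger0_norm ?mulr_ge0 ?enorm_ge0// -sqrtr_sqr ler_wsqrtr//.
have tE : t - 1 = dot (col 1 M - a) a / enorm a ^+ 2.
  by rewrite dotDl dotNl dot_self mulrBl divff// expf_neq0 ?gt_eqF.
have tE' : t + 1 = dot (col 1 M + a) a / enorm a ^+ 2.
  by rewrite dotDl dot_self mulrDl divff// expf_neq0 ?gt_eqF.
rewrite ler_wpDl ?sqr_ge0// le_min; apply/andP; split;
  rewrite ler_sqr ?nnegrE ?mulr_ge0 ?enorm_ge0//;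
  apply: le_trans (enorm_ge_dot _ an0).
- rewrite -tE ler_wpM2l ?enorm_ge0// distrC.
  by rewrite -[X in `|_ - X|]normr1 ler_dist_dist.
- rewrite -tE' ler_wpM2l ?enorm_ge0// distrC.
  by rewrite -[X in `|_ - X|]normr1 -[X in _ <= `|_ + X|]opprK -[X in `|_ - X| <= _]normrN ler_dist_dist.
Qed.

Lemma W11_coord_continuous (R : realType) (phi : W11 R) i j :
  {within `[-1, 1]%classic, continuous (fun x => phi x i j)}.
Proof.
move=> x; apply: (@continuous_comp _ _ _ (phi : subspace _ -> _)
  (fun M : 'M[R]_2 => M i j)); first exact: W11_cont.
exact: coord_continuous.
Qed.

Lemma measurable_enorm d (T : measurableType d) (R : realType) (D : set T)
    m n (M : T -> 'M[R]_(m, n)) :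
  (forall i j, measurable_fun D (fun x => M x i j)) ->
  measurable_fun D (fun x => enorm (M x)).
Proof.
move=> mM; have msqrt : measurable_fun setT (@Num.sqrt R).
  by apply: continuous_measurable_fun; exact: sqrt_continuous.
apply: (measurableT_comp msqrt).
by do 2 (apply: measurable_sum => ?); exact: measurable_funX.
Qed.

Lemma integrable_test (R : realType) (f g : R -> R) :
  (@lebesgue_measure R).-integrable `[-1, 1]%classic (EFin \o f) ->
  continuous g ->
  (@lebesgue_measure R).-integrable `]-1, 1[%classic (fun x => (f x * g x)%:E).
Proof.
move=> fi cg.
have : (@lebesgue_measure R).-integrable `[-1, 1]%classic
    ((EFin \o f) \* (EFin \o g))%E.
  apply: integrableMl => //.
    by apply: measurable_funTS; exact: continuous_measurable_fun.
  have cI : compact (g @` `[-1, 1]%classic).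
    by apply: continuous_compact; [exact: continuous_subspaceT|exact: segment_compact].
  have [N [_ NK]] := compact_bounded cI.
  exists (`|N| + 1); split; first exact: num_real.
  move=> M NM x Ix /=; apply: le_trans (ltW NM); apply: NK.
    by rewrite (le_lt_trans (ler_norm _))// ltrDl.
  by exists x.
move=> fgi; apply: integrableS fgi; [exact: measurable_itv|exact: measurable_itv|].
exact: subset_itv_oo_cc.
Qed.

Lemma weak_der_comb (R : realType) (p q dp dq : R -> R) (c d : R) :
  (@lebesgue_measure R).-integrable `[-1, 1]%classic (EFin \o p) ->
  (@lebesgue_measure R).-integrable `[-1, 1]%classic (EFin \o q) ->
  (@lebesgue_measure R).-integrable `[-1, 1]%classic (EFin \o dp) ->
  (@lebesgue_measure R).-integrable `[-1, 1]%classic (EFin \o dq) ->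
  weak_der p dp -> weak_der q dq ->
  weak_der (fun x => c * p x + d * q x) (fun x => c * dp x + d * dq x).
Proof.
move=> ip iq idp idq pdp qdq eta etaC.
have comb (f g h : R -> R) : continuous h ->
    (@lebesgue_measure R).-integrable `[-1, 1]%classic (EFin \o f) ->
    (@lebesgue_measure R).-integrable `[-1, 1]%classic (EFin \o g) ->
    (\int[@lebesgue_measure R]_(x in `](-1)%R, 1%R[) ((c * f x + d * g x) * h x)%:E =
     c%:E * \int[@lebesgue_measure R]_(x in `](-1)%R, 1%R[) (f x * h x)%:E +
     d%:E * \int[@lebesgue_measure R]_(x in `](-1)%R, 1%R[) (g x * h x)%:E)%E.
  move=> ch fi gi; have fhi := integrable_test fi ch; have ghi := integrable_test gi ch.
  rewrite -!integralZl// -integralD//; try exact: integrableZl.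
  by apply: eq_integral => x _; rewrite -!EFinM -EFinD; congr (_%:E); ring.
have [deta cdeta _] := etaC.
have ceta : continuous eta by move=> x; exact: differentiable_continuous.
have cd1 : continuous (derive1 eta).
  by rewrite (_ : derive1 eta = 'D_1 eta)//; apply/funext => x; rewrite derive1E.
rewrite (comb _ _ _ cd1 ip iq) (comb _ _ _ ceta idp idq) pdp// qdq//.
(* Finite integrals allow the opposite to be distributed over the sum in the extended reals. *)
have fin (f : R -> R) : (@lebesgue_measure R).-integrable `[-1, 1]%classic (EFin \o f) ->
    (\int[@lebesgue_measure R]_(x in `](-1)%R, 1%R[) (f x * eta x)%:E)%E \is a fin_num.
  move=> fi; apply: (integrable_fin_num _ (integrable_test fi ceta)).
  exact: measurable_itv.
by rewrite !muleN fin_num_oppeD// fin_numM// fin.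
Qed.

Lemma LW_ge (R : realType) (a : 'cV[R]_2) (W : 'M[R]_2 -> R) (c : R)
    (phi : W11 R) :
  a != 0 -> 0 <= c -> continuous W ->
  (forall M, c * Num.sqrt (W0 a M) <= Num.sqrt (W M)) ->
  phi (-1) = tensor a (e2 R) -> phi 1 = - tensor a (e2 R) ->
  ((2 * c * enorm a ^+ 2)%:E <= LW W phi)%E.
Proof.
move=> an0 c0 W_cont W0W phiN1 phi1.
have a0 := enorm_gt0 an0; pose al := enorm a ^+ 2.
have al0 : 0 < al by rewrite exprn_gt0.
pose p x := dot (col 1 (phi x)) a / al.
pose psi x := dot (col 1 (W11_der phi x)) a / al.
have pE : p = fun x => a 0 0 / al * phi x 0 1 + a 1 0 / al * phi x 1 1.
  by apply/funext => x; rewrite /p dotE !mxE; ring.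
have psiE : psi = fun x => a 0 0 / al * W11_der phi x 0 1
    + a 1 0 / al * W11_der phi x 1 1.
  by apply/funext => x; rewrite /psi dotE !mxE; ring.
have cp : {within `[-1, 1]%classic, continuous p}.
  rewrite pE => x; apply: cvgD; apply: cvgMr; exact: W11_coord_continuous.
have ipsi : (@lebesgue_measure R).-integrable `[-1, 1]%classic (EFin \o psi).
  rewrite psiE (_ : EFin \o _ = (fun x => (a 0 0 / al)%:E * (W11_der phi x 0 1)%:E) \+
    (fun x => (a 1 0 / al)%:E * (W11_der phi x 1 1)%:E))%E//.
  by apply: integrableD => //; apply: integrableZl => //; exact: W11_der_L1.
have ppsi : weak_der p psi.
  rewrite pE psiE; apply: weak_der_comb; try exact: W11_fun_L1;
    try exact: W11_der_L1; move=> eta; exact: W11_derP.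
have colA : col 1 (tensor a (e2 R)) = a.
  by apply/colP => i; rewrite mxE tensor_e2E eqxx mulr1.
have pN1 : p (-1) = 1 by rewrite /p phiN1 colA dot_self divff// gt_eqF.
have p1 : p 1 = -1.
  rewrite /p phi1 (_ : col 1 (- _) = - a); last first.
    by apply/colP => i; rewrite !mxE big_ord1 !mxE /= mulr1.
  by rewrite dotNl dot_self mulNr divff// gt_eqF.
have mpsi : measurable_fun (`[-1, 1]%classic : set (measurableTypeR R)) psi.
  by apply/measurable_EFinP; exact: measurable_int ipsi.
have mp : measurable_fun (`[-1, 1]%classic : set (measurableTypeR R)) p.
  exact: subspace_continuous_measurable_fun.
have mw : measurable_fun (`[-1, 1]%classic : set (measurableTypeR R))
    (fun x => `|1 - `|p x| | * `|psi x|).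
  apply: measurable_funM; apply: measurableT_comp => //.
  by apply: measurable_funB => //; exact: measurableT_comp.
have mW : measurable_fun (`[-1, 1]%classic : set (measurableTypeR R))
    (fun x => Num.sqrt (W (phi x))).
  have msqrt : measurable_fun setT (@Num.sqrt R).
    by apply: continuous_measurable_fun; exact: sqrt_continuous.
  apply: (measurableT_comp msqrt).
  apply: subspace_continuous_measurable_fun => // x.
  apply: (@continuous_comp _ _ _ (phi : subspace _ -> _) W); first exact: W11_cont.
  exact: W_cont.
have mder : measurable_fun (`[-1, 1]%classic : set (measurableTypeR R))
    (fun x => enorm (W11_der phi x)).
  apply: measurable_enorm => i j; apply/measurable_EFinP.
  exact: measurable_int (W11_der_L1 phi i j).
rewrite /LW -mulrA EFinM; apply: lee_wpmul2l; first by rewrite lee_fin.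
apply: (@le_trans _ _ ((c * al)%:E * \int[@lebesgue_measure R]_(x in `[(-1)%R, 1%R])
    (`|1 - `|p x| | * `|psi x|)%:E)%E).
  rewrite -[leLHS]mule1; apply: lee_wpmul2l; first by rewrite lee_fin mulr_ge0// ltW.
  exact: weak_der_weighted_length cp ipsi ppsi pN1 p1.
rewrite -ge0_integralZl//; last 2 first.
- exact/measurable_EFinP.
- by rewrite lee_fin mulr_ge0// ltW.
apply: ge0_le_integral => //.
- by move=> x _; rewrite lee_fin !mulr_ge0// ltW.
- by apply: emeasurable_funM => //; exact/measurable_EFinP.
- by apply/measurable_EFinP; exact: measurable_funM.
move=> x _; rewrite -EFinM lee_fin.
(* One factor |a| goes to each part: c |a| |1 - |p|| bounds sqrt(W(phi)) from below, and |a| |psi|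
   bounds |phi'|. *)
have -> : c * al * (`|1 - `|p x| | * `|psi x|) =
    (c * (enorm a * `|1 - `|p x| |)) * (enorm a * `|psi x|) by rewrite /al; ring.
apply: ler_pM.
- by rewrite !mulr_ge0 ?enorm_ge0.
- by rewrite mulr_ge0 ?enorm_ge0.
- by rewrite (le_trans _ (W0W _))// ler_wpM2l// sqrt_W0_ge.
- by rewrite (le_trans (enorm_ge_dot _ an0))// enorm_col_le.
Qed.

(** * The wells, and the three conclusions *)

Lemma W0_eq0 (R : realType) (a : 'cV[R]_2) (M : 'M[R]_2) :
  W0 a M = 0 <-> (M = tensor a (e2 R) \/ M = - tensor a (e2 R)).
Proof.
have enorm_eq0 (v : 'cV[R]_2) : enorm v ^+ 2 = 0 -> v = 0.
  move=> v0; apply/eqP; apply: contraPT v0 => /enorm_gt0 v0 /eqP.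
  by rewrite gt_eqF// exprn_gt0.
have colP2 (v : 'cV[R]_2) : col 0 M = 0 -> col 1 M = v -> M = tensor v (e2 R).
  move=> M0 M1; apply/matrixP => i j; rewrite tensor_e2E.
  have [->|j1] := eqVneq j 1; first by rewrite mulr1 -M1 mxE.
  have -> : j = 0 by apply/val_inj; case: j j1 => -[|[]].
  by rewrite mulr0; move/colP/(_ i): M0; rewrite !mxE.
have tN : - tensor a (e2 R) = tensor (- a) (e2 R) by rewrite /tensor mulNmx.
split.
  move=> /eqP; rewrite /W0 paddr_eq0 ?sqr_ge0 ?le_min ?sqr_ge0// => /andP[/eqP/enorm_eq0 M0].
  rewrite minEle; case: ifPn => _ /eqP/enorm_eq0 /eqP.
    by rewrite subr_eq0 => /eqP M1; left; exact: colP2.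
  by rewrite addr_eq0 => /eqP M1; right; rewrite tN; exact: colP2.
have W00 t : `|t| = 1 -> W0 a (t *: tensor a (e2 R)) = 0.
  move=> t1; apply/eqP; rewrite eq_le (le_trans (W0_scale_tensor _ _))/=.
    by rewrite addr_ge0 ?sqr_ge0// le_min !sqr_ge0.
  by rewrite t1 subrr mul0r expr0n.
case=> ->; first by rewrite -[tensor _ _]scale1r W00 ?normr1.
by rewrite -scaleN1r W00 ?normrN ?normr1.
Qed.

Theorem theorem3p10 (R : realType) (a : 'cV[R]_2) (A B : 'M[R]_2)
  (W : 'M[R]_2 -> R) (sigma : R)
  (a_neq0 : a != 0)
  (A_def : A = tensor a (e2 R))
  (B_def : B = - A)
  (W_ge0 : forall M, 0 <= W M)
  (W_cont : continuous W)
  (sigma_gt0 : 0 < sigma)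
  (sigma_lt : sigma < 2^-1)
  (W_close : forall M,
     `|Num.sqrt (W M) - Num.sqrt (W0 a M)| <= sigma * Num.sqrt (W0 a M)) :
  [/\ exists C : R, 0 < C /\
        forall M, C^-1 * W0 a M <= W M /\ W M <= C * W0 a M,
      forall h : R, 0 < h -> (Kstar W A B h < 3%:E * dW W A B)%E &
      forall M, W M = 0 <-> (M = A \/ M = B)].
Proof.
have c1 : 0 < 1 + sigma by lra.
have c2 : 0 < 1 - sigma by lra.
have W0_ge0 M : 0 <= W0 a M.
  by rewrite addr_ge0 ?sqr_ge0// le_min !sqr_ge0.
have sqrt_lo M : (1 - sigma) * Num.sqrt (W0 a M) <= Num.sqrt (W M).
  by have := W_close M; rewrite ler_norml => /andP[? ?]; lra.
have sqrt_hi M : Num.sqrt (W M) <= (1 + sigma) * Num.sqrt (W0 a M).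
  by have := W_close M; rewrite ler_norml => /andP[? ?]; lra.
have lo M : (1 - sigma) ^+ 2 * W0 a M <= W M.
  rewrite -[W M]sqr_sqrtr// -[W0 a M]sqr_sqrtr// -exprMn.
  by rewrite ler_sqr ?nnegrE ?mulr_ge0 ?sqrtr_ge0// ltW.
have hi M : W M <= (1 + sigma) ^+ 2 * W0 a M.
  rewrite -[W M]sqr_sqrtr// -[W0 a M]sqr_sqrtr// -exprMn.
  by rewrite ler_sqr ?nnegrE ?mulr_ge0 ?sqrtr_ge0// ltW.
split.
(* For 0 < sigma < 1/2, (1 - sigma)^2 exceeds 1/4 and (1 + sigma)^2 stays below 9/4. *)
- exists 4; split=> // M; split.
    rewrite (le_trans _ (lo M))// ler_wpM2r//; nra.
  by rewrite (le_trans (hi M))// ler_wpM2r//; nra.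
- move=> h h0; have a0 := enorm_gt0 a_neq0.
  rewrite B_def A_def; apply: (le_lt_trans (Kstar_le c1 h0 W_ge0 W_cont hi)).
  (* The strict inequality sits between the two explicit bounds and uses |a| > 0; the infimum
     defining d_W then keeps only a weak one. *)
  apply: (@lt_le_trans _ _ (3 * (2 * (1 - sigma) * enorm a ^+ 2))%:E).
    have : 0 < enorm a ^+ 2 by rewrite exprn_gt0.
    by rewrite lte_fin; nra.
  rewrite EFinM; apply: lee_wpmul2l; first by rewrite lee_fin.
  apply: le_ereal_inf_tmp => _ [phi [phiN1 phi1] <-].
  exact: (LW_ge a_neq0 (ltW c2)).
- move=> M.
  (* The two-sided comparison, with positive factors, makes the zero sets coincide. *)
  have -> : W M = 0 <-> W0 a M = 0.
    split=> [W0M|W0M]; apply/eqP; rewrite eq_le.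
      rewrite W0_ge0 andbT -(ler_pM2l (exprn_gt0 2 c2)) mulr0.
      by rewrite (le_trans (lo M))// W0M.
    by rewrite W_ge0 andbT (le_trans (hi M))// W0M mulr0.
  rewrite A_def B_def A_def; exact: W0_eq0.
Qed.
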